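(* Let $G=(V,E)$ be an infinite, connected graph of bounded degree satisfying quadratic volume growth VG(2) and the Poincaré inequality PI. Fix $x_0\in V$ and let $G_n=B_{R_n}(x_0)$ be an exhaustion of $G$ by metric balls, $N_n=|V(G_n)|\to\infty$. Suppose there are constants $a_1,a_2>0$, $\mathcal{G}>0$, $t_0<\infty$, $C<\infty$ and $\alpha>0$ such that $$a_1t^{-1}\le p_t(x,x)\le a_2t^{-1}\qquad\text{for all }x\in V,\ t\ge t_0,$$ and $$\left|\frac1{N_n}\sum_{x\in G_n}\bigl(t\,p_t(x,x)-\mathcal{G}\bigr)\right|\le C(\log t)^{-\alpha}\qquad\text{for all }t\ge t_0\text{ and all }n.$$ Then, as $n\to\infty$: 1. if $\alpha>1$, then $Z_n(1)=\mathcal{G}N_n\log N_n+O(N_n)$; 2. if $\alpha=1$, then $Z_n(1)=\mathcal{G}N_n\log N_n+O(N_n\log\log N_n)$.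
   Context: For a connected graph $G=(V,E)$, $d_G$ is the graph distance, $B_R(x)=\{y\in V: d_G(x,y)\le R\}$ the closed ball, and $V(x,R)=|B_R(x)|$ its number of vertices. $\log$ is the natural logarithm. VG(2): there exist $c_1,c_2>0$ such that $c_1R^2\le V(x,R)\le c_2R^2$ for all $x\in V$ and $R\ge 1$. PI: there exists $C_P>0$ such that for every ball $B_R=B_R(x)$ and every $f:V\to\mathbb{R}$, $\sum_{y\in B_R}(f(y)-\bar f_{B_R})^2\le C_PR^2\,\mathcal{E}_{B_{2R}}(f,f)$, where $\bar f_{B_R}$ is the average of $f$ over $B_R$ with respect to counting measure, $B_{2R}=B_{2R}(x)$, and $\mathcal{E}_U(f,f)=\sum_{\{y,z\}\in E,\ y,z\in U}(f(y)-f(z))^2$. Lazy simple random walk (LSRW): the discrete-time Markov chain $(X_t)_{t\ge0}$ on $V$ with transition matrix $P=\frac12(I+P_{SRW})$, where $P_{SRW}(x,y)=1/\deg(x)$ if $y\sim x$ and $0$ otherwise. Its heat kernel is $p_t(x,y)=\mathbb{P}_x[X_t=y]$, with integer times $t$. Dirichlet objects: for a finite vertex set $H\subset V$, $\mathcal{L}_H$ is the restriction to $H$ of $I-P$ (the matrix $(I-P)(x,y)$, $x,y\in H$), i.e. the generator of the LSRW killed upon exiting $H$. $Z_n(1)=\operatorname{tr}(\mathcal{L}_{G_n}^{-1})$. *)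

(* Defs.v *)
From HB Require Import structures.
From mathcomp Require Import all_boot all_order all_algebra finmap.
From mathcomp Require Import all_classical all_reals all_analysis.

Set Implicit Arguments.
Unset Strict Implicit.
Unset Printing Implicit Defensive.

Import Order.TTheory GRing.Theory Num.Theory.
Import numFieldNormedType.Exports.

Local Open Scope classical_set_scope.
Local Open Scope ring_scope.

Record sgraph (V : choiceType) := SGraph {
  adj : rel V;
  adj_sym : symmetric adj;
  adj_irr : irreflexive adj
}.

Section Graph.
Variables (V : choiceType) (G : sgraph V).

Definition infinite_graph : Prop := infinite_set [set: V].

Definition connected_graph : Prop :=
  forall x y, exists2 p, path (adj G) x p & last x p = y.

(* [fset_set] turns a finite set into a {fset V} (and an infinite one into
   fset0); [bounded_degree] asserts finiteness, which makes the neighbourhoods,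
   and hence the balls below, finite. *)
Definition nbrs (x : V) : {fset V} := fset_set [set y | adj G x y].

Definition deg (x : V) : nat := #|` nbrs x|.

Definition bounded_degree : Prop :=
  exists D : nat, forall x, finite_set [set y | adj G x y] /\ (deg x <= D)%N.

Definition has_walk (x y : V) (n : nat) : bool :=
  `[< exists p, [/\ path (adj G) x p, last x p = y & size p = n] >].

(* The default value 0 is only used for vertices in different components. *)
Definition gdist (x y : V) : nat :=
  if pselect (exists n, has_walk x y n) is left h then ex_minn h else 0%N.

Variable R : realType.
Implicit Types (x y z : V) (r : R) (f : V -> R) (U H : {fset V}).

Definition gball x r : {fset V} := fset_set [set y | (gdist x y)%:R <= r].

Definition gvol x r : nat := #|` gball x r|.

Definition VG2 : Prop :=
  exists c1 c2 : R, [/\ 0 < c1, 0 < c2 &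
    forall x r, 1 <= r ->
      c1 * r ^+ 2 <= (gvol x r)%:R /\ (gvol x r)%:R <= c2 * r ^+ 2].

Definition fmean U f : R := (#|` U|)%:R^-1 * \sum_(y <- U) f y.

(* The double sum runs over ordered pairs and so meets each edge {y, z}
   twice, whence the factor 1/2. *)
Definition energy U f : R :=
  2^-1 * \sum_(y <- U) \sum_(z <- U | adj G y z) (f y - f z) ^+ 2.

Definition poincare : Prop :=
  exists2 CP : R, 0 < CP & forall x r f, 0 <= r ->
    \sum_(y <- gball x r) (f y - fmean (gball x r) f) ^+ 2
      <= CP * r ^+ 2 * energy (gball x (2 * r)) f.

Definition srw x y : R := if adj G x y then (deg x)%:R^-1 else 0.

Definition lsrw x y : R := 2^-1 * ((x == y)%:R + srw x y).

(* P_x[X_t = y] is the entry (x, y) of the t-th power of the transition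
   matrix.  The sum over z has finite support when the graph is locally
   finite. *)
Fixpoint heat_kernel (t : nat) x y : R :=
  if t is s.+1 then \sum_(z \in [set: V]) lsrw x z * heat_kernel s z y
  else (x == y)%:R.

(* Matrices are indexed by ordinals, so H is enumerated; the trace does not
   depend on the enumeration. *)
Definition dirichlet H : 'M[R]_(#|{: H}|) :=
  \matrix_(i, j) let x := val (enum_val i) in let y := val (enum_val j) in
    (x == y)%:R - lsrw x y.

(* [invmx] is the inverse only on invertible matrices; [dirichlet H] is one
   for finite H in an infinite connected locally finite graph, since the
   killed walk is transient. *)
Definition zeta1 H : R := \tr (invmx (dirichlet H)).

Definition exhaustion (K : nat -> {fset V}) : Prop :=
  (forall n, (K n `<=` K n.+1)%fset) /\ (forall x, exists n, x \in K n).

End Graph.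

Arguments gball {V} G {R} x r.
Arguments VG2 {V} G R.
Arguments poincare {V} G R.
Arguments heat_kernel {V} G {R} t x y.
Arguments zeta1 {V} G R H.

(* Main.v *)
Require Import Defs.
From HB Require Import structures.
From mathcomp Require Import all_boot all_order all_algebra finmap.
From mathcomp Require Import all_classical all_reals all_analysis.
From mathcomp Require Import zify ring lra.

Set Implicit Arguments.
Unset Strict Implicit.
Unset Printing Implicit Defensive.

Import Order.TTheory GRing.Theory Num.Theory.
Import numFieldNormedType.Exports.

Local Open Scope classical_set_scope.
Local Open Scope ring_scope.

(** Write [B] for the ball of radius [rho], [N] for its number of vertices and
    [killed B t] for the heat kernel of the walk killed outside [B].  Then
    [zeta1 B] is the sum over [t] of the traces of [killed B t], and the theorem
    says that this sum may be replaced by that of [heat_kernel t x x] over [B]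
    and over the times [t < L N], with [L] a constant, at a bounded cost per
    vertex.  On the remaining finite sum the averaged estimate replaces
    [heat_kernel t x x] by [g / t], which gives [g N (ln N + O(1))] plus [N]
    times the sum of [(ln t) ^ (- alpha) / t].  The latter is bounded for
    [alpha > 1] and at most [ln (ln N) + O(1)] for [alpha = 1].

    Late times are harmless because a kernel bounded by [A / t] cannot hold more
    than half of a unit mass on [N] points once [t >= 2 A N]; a maximum
    principle turns this into invertibility, positivity and row sums [O(N)] of
    the Green function ([zeta1_bounds]).

    Before that time, replacing the killed kernel by the free one costs at [x]
    what the free walk collects at [x] after leaving [B] ([killing_deficit_le]).
    If [x] is at distance [r] from the complement this is at most the sum over
    [t < L N] of [killed B' t y x], for a large finite set [B'] and a vertex [y]
    with [d(x,y) >= r].  Two heat kernel bounds control it.  The diagonal bound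
    and reversibility give [A / t] everywhere ([killed_le_time]).  Away from the
    diagonal the kernel is at most [C / d(x,y) ^ 2] at all times
    ([killed_le_dist]); this weak form of a Gaussian bound follows from an
    energy inequality for the fourth moment of the squared kernel
    ([moment2_le]).  Using the second bound for [t < r ^ 2] and the first one
    afterwards, the cost at [x] is [O(1 + ln (rho / r))].

    Finally the sum of [ln (rho / r)] over [B] is [O(N)], because annuli near
    the boundary of a ball are thin: their volume decays by a definite factor
    whenever their width is divided by four ([annulus_growth]), a consequence of
    quadratic growth and of the existence of geodesics. *)

(** * The graph distance and its balls *)

Section Distance.
Variables (V : choiceType) (G : sgraph V).
Implicit Types (x y z w : V) (m n k : nat).

Lemma has_walkP x y n :
  reflect (exists p, [/\ path (adj G) x p, last x p = y & size p = n])
          (has_walk G x y n).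
Proof. exact: asboolP. Qed.

Lemma has_walk_cat x y z m n :
  has_walk G x y m -> has_walk G y z n -> has_walk G x z (m + n).
Proof.
move=> /has_walkP[p [xp py <-]] /has_walkP[q [yq qz <-]].
apply/has_walkP; exists (p ++ q); split; last by rewrite size_cat.
- by rewrite cat_path xp py yq.
- by rewrite last_cat py.
Qed.

Lemma has_walk_split x y m n : has_walk G x y (m + n) ->
  exists2 w, has_walk G x w m & has_walk G w y n.
Proof.
move=> /has_walkP[p [xp py sp]].
move: xp py; rewrite -{1 2}(cat_take_drop m p) cat_path last_cat => /andP[xt td] l.
exists (last x (take m p)); apply/has_walkP.
- exists (take m p); split=> //; rewrite size_take sp; case: ltnP; lia.
- by exists (drop m p); split=> //; rewrite size_drop sp; lia.
Qed.

Lemma has_walk_sym x y n : has_walk G x y n -> has_walk G y x n.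
Proof.
move=> /has_walkP[p [xp py sp]]; apply/has_walkP.
exists (rev (belast x p)); split; last by rewrite size_rev size_belast.
- by rewrite -py rev_path (eq_path (e' := adj G)) // => u v; rewrite adj_sym.
- case: p xp py sp => [|a p] //= _ _ _; by rewrite rev_cons last_rcons.
Qed.

Hypothesis conn : connected_graph G.

Lemma gdistP x y :
  has_walk G x y (gdist G x y) /\ (forall n, has_walk G x y n -> (gdist G x y <= n)%N).
Proof.
rewrite /gdist; case: pselect => [h|[]]; first by case: ex_minnP.
by have [p xp py] := conn x y; exists (size p); apply/has_walkP; exists p.
Qed.

Lemma gdist_walk x y : has_walk G x y (gdist G x y).
Proof. by have [] := gdistP x y. Qed.

Lemma gdist_le x y n : has_walk G x y n -> (gdist G x y <= n)%N.
Proof. by have [_] := gdistP x y; apply. Qed.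

Lemma gdistxx x : gdist G x x = 0%N.
Proof. by apply/eqP; rewrite -leqn0 gdist_le //; apply/has_walkP; exists [::]. Qed.

Lemma gdist_sym x y : gdist G x y = gdist G y x.
Proof. by apply/eqP; rewrite eqn_leq !gdist_le // has_walk_sym // gdist_walk. Qed.

Lemma gdist_triangle y x z : (gdist G x z <= gdist G x y + gdist G y z)%N.
Proof. by apply/gdist_le/has_walk_cat; apply: gdist_walk. Qed.

Lemma gdist_adj x y : adj G x y -> (gdist G x y <= 1)%N.
Proof. by move=> xy; apply/gdist_le/has_walkP; exists [:: y]; rewrite /= xy. Qed.

Lemma gdist_eq0 x y : gdist G x y = 0%N -> x = y.
Proof.
by move=> d; have := gdist_walk x y; rewrite d => /has_walkP[[|a p] [_ /= ? ?]].
Qed.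

(** A shortest walk from [x] to [y] passes at every intermediate distance. *)
Lemma gdist_between x y k : (k <= gdist G x y)%N ->
  exists2 w, (gdist G w y <= k)%N & (gdist G x w + k = gdist G x y)%N.
Proof.
move=> kd; have := gdist_walk x y; rewrite -{1}(subnK kd).
move=> /has_walk_split[w /gdist_le xw /gdist_le wy]; exists w => //.
by have := gdist_triangle w x y; lia.
Qed.

Hypothesis bdeg : bounded_degree G.

Lemma in_nbrs x y : (y \in nbrs G x) = adj G x y.
Proof.
have [D /(_ x)[fin _]] := bdeg.
by rewrite in_fset_set //; apply/idP/idP; rewrite inE.
Qed.

Lemma finite_gball x k : finite_set [set y | (gdist G x y <= k)%N].
Proof.
elim: k => [|k IH].
  apply: (sub_finite_set (B := [set x])); last exact: finite_set1.
  by move=> y /=; rewrite leqn0 => /eqP /gdist_eq0 ->.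
have fin : finite_set ([set y | (gdist G x y <= k)%N] `|`
    \bigcup_(w in [set y | (gdist G x y <= k)%N]) [set y | adj G w y]).
  rewrite finite_setU; split=> //; apply: bigcup_finite => // w _.
  by have [D /(_ w)[]] := bdeg.
apply: sub_finite_set fin => y /= dy.
case: (leqP (gdist G x y) k) => [|ky]; first by left.
right; have [|w wy xw] := @gdist_between x y 1; first by apply: leq_ltn_trans ky.
exists w => /=; first by lia.
have := gdist_walk w y; case: (gdist G w y) wy (@gdist_eq0 w y) => [|[|//]] _.
  by move=> /(_ erefl) wE; move: xw ky dy; rewrite wE; lia.
by move=> _ /has_walkP[[|a [|b p]] [//= /andP[wa _] <-]].
Qed.

Variable R : realType.

Lemma in_gball x y k : (y \in gball G x (k%:R : R)) = (gdist G x y <= k)%N.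
Proof.
have sE : [set y | (gdist G x y)%:R <= k%:R :> R] = [set y | (gdist G x y <= k)%N].
  by apply/seteqP; split=> z /=; rewrite ler_nat.
rewrite /gball sE in_fset_set; last exact: finite_gball.
by apply/idP/idP; rewrite inE.
Qed.

Lemma gball_truncn x (r : R) : 0 <= r -> gball G x r = gball G x ((Num.truncn r)%:R : R).
Proof.
move=> r0; rewrite /gball; congr fset_set; apply/seteqP.
by split=> y /=; rewrite ler_nat truncn_ge_nat.
Qed.

Lemma deg_gt0 x : infinite_graph V -> (0 < deg G x)%N.
Proof.
move=> inf; rewrite cardfs_gt0; apply/fset0Pn.
have [y yx] : exists y, y != x.
  apply: contrapT => no; apply: inf; apply: (sub_finite_set (B := [set x])) => [y _|].
    by apply: contrapT => /eqP yx; apply: no; exists y.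
  exact: finite_set1.
have [[|z p] /= xp yp] := conn x y; first by rewrite yp eqxx in yx.
by exists z; rewrite in_nbrs; case/andP: xp.
Qed.

End Distance.

(** * The walk killed outside a finite set *)

Lemma big_seq_delta (I : choiceType) (R : pzSemiRingType) (S : seq I) x (F : I -> R) :
  uniq S -> \sum_(z <- S) (x == z)%:R * F z = (x \in S)%:R * F x.
Proof.
move=> uS; case: (boolP (x \in S)) => xS.
  rewrite (bigD1_seq x) //= eqxx big1 ?addr0 // => z zx.
  by rewrite eq_sym (negbTE zx) mul0r.
rewrite mul0r big_seq big1 // => z zS; case: eqP => [xz|]; last by rewrite mul0r.
by rewrite xz zS in xS.
Qed.

Lemma ler_sum_seq (I : eqType) (R : numDomainType) (S : seq I) (E F : I -> R) :
  {in S, forall x, E x <= F x} -> \sum_(x <- S) E x <= \sum_(x <- S) F x.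
Proof. by move=> EF; rewrite !big_seq; apply: ler_sum. Qed.

Lemma sumr_ge0_seq (I : eqType) (R : numDomainType) (S : seq I) (F : I -> R) :
  {in S, forall x, 0 <= F x} -> 0 <= \sum_(x <- S) F x.
Proof. by move=> F0; rewrite big_seq; apply: sumr_ge0. Qed.

Lemma sum_fsubset (I : choiceType) (R : pzSemiRingType) (S T : {fset I}) (F : I -> R) :
  (S `<=` T)%fset -> \sum_(x <- S) F x = \sum_(x <- T) (x \in S)%:R * F x.
Proof.
move=> /fsubsetP ST; rewrite [RHS](bigID [in S]) /= [X in _ + X]big1 ?addr0.
  rewrite -[RHS]big_filter (perm_big [seq x <- T | x \in S]).
    by rewrite !big_filter; apply: eq_bigr => x ->; rewrite mul1r.
  apply: uniq_perm; rewrite ?filter_uniq ?fset_uniq // => x.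
  by rewrite mem_filter; case: (boolP (x \in S)) => // /ST ->.
by move=> x /negbTE ->; rewrite mul0r.
Qed.

Lemma ler_sum_fsubset (I : choiceType) (R : numDomainType) (S T : {fset I})
    (F : I -> R) : (S `<=` T)%fset -> (forall x, 0 <= F x) ->
  \sum_(x <- S) F x <= \sum_(x <- T) F x.
Proof.
move=> ST F0; rewrite (sum_fsubset _ ST); apply: ler_sum => x _.
by case: (x \in S); rewrite ?mul1r ?mul0r.
Qed.

Section Killed.
Variables (V : choiceType) (G : sgraph V) (R : realType).
Implicit Types (x y z w : V) (s t : nat) (H S B : {fset V}).

Local Arguments lsrw {V} G R x y : simpl never.
Local Notation P := (lsrw G R).
Local Notation "'pi' x" := ((deg G x)%:R : R) (at level 10, x at level 8).

(** The [t]-th power of the restriction of [lsrw] to [H], extended by [0] to all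
    of [V] so that the kernels of different sets can be compared. *)
Fixpoint killed H (t : nat) x y : R :=
  if t is s.+1 then (x \in H)%:R * \sum_(z <- H) P x z * killed H s z y
  else (x \in H)%:R * (x == y)%:R.

Lemma lsrw_ge0 x y : 0 <= P x y.
Proof.
rewrite /lsrw mulr_ge0 ?invr_ge0 ?addr_ge0 ?ler0n // /srw.
by case: ifP => // _; rewrite invr_ge0 ler0n.
Qed.

Lemma killed_ge0 H t x y : 0 <= killed H t x y.
Proof.
elim: t x => [|t IH] x /=; first by rewrite mulr_ge0.
by rewrite mulr_ge0 ?sumr_ge0 // => z _; rewrite mulr_ge0 ?lsrw_ge0.
Qed.

Lemma killed_outl H t x y : x \notin H -> killed H t x y = 0.
Proof. by case: t => [|t] /negbTE /= ->; rewrite mul0r. Qed.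

Lemma killed_outr H t x y : y \notin H -> killed H t x y = 0.
Proof.
move=> yH; elim: t x => [|t IH] x /=.
  by case: eqP yH => [<- /negbTE ->|]; rewrite ?mul0r ?mulr0.
by rewrite big1 ?mulr0 // => z _; rewrite IH mulr0.
Qed.

Lemma killedS H t x y : x \in H ->
  killed H t.+1 x y = \sum_(z <- H) P x z * killed H t z y.
Proof. by move=> /= ->; rewrite mul1r. Qed.

Lemma killedD H s t x y :
  killed H (s + t) x y = \sum_(z <- H) killed H s x z * killed H t z y.
Proof.
elim: s x => [|s IH] x.
  rewrite (eq_bigr (fun z => (x == z)%:R * ((x \in H)%:R * killed H t z y))); last first.
    by move=> z _ /=; rewrite mulrCA mulrA.
  rewrite big_seq_delta ?fset_uniq // add0n.
  by case: (boolP (x \in H)) => xH; [rewrite !mul1r | rewrite mul0r killed_outl].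
case: (boolP (x \in H)) => xH; last first.
  by rewrite killed_outl // big1 // => z _; rewrite killed_outl ?mul0r.
rewrite addSn killedS //.
rewrite [RHS](eq_bigr (fun z => \sum_(w <- H) P x w * (killed H s w z * killed H t z y))).
  rewrite exchange_big; apply: eq_bigr => w _; by rewrite IH mulr_sumr.
move=> z _; rewrite killedS // mulr_suml.
by apply: eq_bigr => w _; rewrite mulrA.
Qed.

Hypotheses (inf : infinite_graph V) (conn : connected_graph G).
Hypothesis bdeg : bounded_degree G.

Lemma degR_gt0 x : 0 < pi x.
Proof. by rewrite ltr0n deg_gt0. Qed.

Lemma sum_adj_le S x : \sum_(z <- S) (adj G x z)%:R <= pi x.
Proof.
rewrite -natr_sum ler_nat -big_mkcond sum1_count -size_filter /deg cardfE -cardfE.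
apply: uniq_leq_size; first by rewrite filter_uniq ?fset_uniq.
by move=> z; rewrite mem_filter in_nbrs // => /andP[].
Qed.

Lemma deg_lsrw x z :
  pi x * P x z = 2^-1 * (pi x * (x == z)%:R + (adj G x z)%:R).
Proof.
rewrite /lsrw /srw mulrCA mulrDr.
by case: (adj G x z); rewrite ?divff ?mulr0 // gt_eqF ?degR_gt0.
Qed.

Lemma deg_lsrw_sym x z : pi x * P x z = pi z * P z x.
Proof.
by rewrite !deg_lsrw adj_sym eq_sym; case: eqP => [->|] //; rewrite !mulr0.
Qed.

Lemma lsrw_sum_le1 S x : \sum_(z <- S) P x z <= 1.
Proof.
rewrite -(ler_pM2l (degR_gt0 x)) mulr1 big_distrr /=.
rewrite (eq_bigr _ (fun z _ => deg_lsrw x z)) -big_distrr /= big_split /=.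
rewrite (eq_bigr (fun z => (x == z)%:R * pi x)); last by move=> z _; rewrite mulrC.
rewrite big_seq_delta ?fset_uniq //.
have := sum_adj_le S x; have := degR_gt0 x.
by case: (x \in S); rewrite ?mul1r ?mul0r; lra.
Qed.

Lemma killed_sum_le1 H S t x : \sum_(y <- S) killed H t x y <= 1.
Proof.
elim: t x => [|t IH] x /=.
  rewrite -big_distrr /= (eq_bigr (fun y => (x == y)%:R * 1)); last first.
    by move=> y _; rewrite mulr1.
  rewrite big_seq_delta ?fset_uniq //.
  by case: (x \in H); case: (x \in S); rewrite ?mul1r ?mul0r ?ler01.
rewrite -big_distrr /= exchange_big /=.
apply: (le_trans (y := \sum_(z <- H) P x z)); last exact: lsrw_sum_le1.
have le : \sum_(z <- H) \sum_(y <- S) P x z * killed H t z y <= \sum_(z <- H) P x z.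
  apply: ler_sum => z _; rewrite -big_distrr /= ler_piMr ?lsrw_ge0 //.
case: (x \in H); rewrite ?mul1r ?mul0r //.
by apply: sumr_ge0 => z _; apply: lsrw_ge0.
Qed.

Lemma killed_le1 H t x y : killed H t x y <= 1.
Proof. by have := killed_sum_le1 H [fset y]%fset t x; rewrite big_seq_fset1. Qed.

(** Reversibility survives killing, which acts on both variables alike. *)
Lemma killed_sym H t x y : pi x * killed H t x y = pi y * killed H t y x.
Proof.
elim: t x y => [|t IH] x y.
  rewrite /= [y == x]eq_sym; case: eqP => [->|] //; by rewrite !mulr0.
have k1 z w : z \in H -> w \in H -> killed H 1 z w = P z w.
  move=> zH wH; rewrite killedS // (eq_big_seq (fun u => (w == u)%:R * P z u)).
    by rewrite big_seq_delta ?fset_uniq // wH mul1r.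
  by move=> u uH /=; rewrite uH mul1r mulrC eq_sym.
case: (boolP (x \in H)) => xH; last by rewrite killed_outl // killed_outr // !mulr0.
rewrite -[in RHS]addn1 killedD killedS // !mulr_sumr.
apply: eq_big_seq => z zH; by rewrite k1 // mulrA deg_lsrw_sym mulrAC IH -mulrA.
Qed.

Lemma heat_kernelS S t x y : x \in S -> (nbrs G x `<=` S)%fset ->
  heat_kernel G t.+1 x y = \sum_(z <- S) P x z * heat_kernel G t z y.
Proof.
move=> xS /fsubsetP nS /=; rewrite [RHS]fsbig_seq ?fset_uniq //; symmetry; apply: fsbig_widen => // z [_ /= /negP zS].
rewrite /lsrw /srw; case: eqP => [xz|_]; first by rewrite /= -xz xS in zS.
case: ifP => [xz|_]; first by rewrite nS ?in_nbrs in zS.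
by rewrite addr0 mulr0 mul0r.
Qed.

Lemma heat_kernel_ge0 t x y : 0 <= heat_kernel G t x y :> R.
Proof.
elim: t x => [|t IH] x; first by rewrite ler0n.
rewrite (@heat_kernelS (x |` nbrs G x)%fset) ?fset1U1 ?fsubsetU1 //.
by apply: sumr_ge0 => z _; rewrite mulr_ge0 ?lsrw_ge0.
Qed.

Lemma killed_le_heat_kernel H t x y : killed H t x y <= heat_kernel G t x y.
Proof.
elim: t x => [|t IH] x; first by rewrite /=; case: (x \in H); rewrite ?mul1r ?mul0r.
case: (boolP (x \in H)) => xH; last by rewrite killed_outl ?heat_kernel_ge0.
rewrite killedS // (@heat_kernelS (nbrs G x `|` H)%fset) ?inE ?xH ?orbT ?fsubsetUl //.
apply: (le_trans (y := \sum_(z <- H) P x z * heat_kernel G t z y)).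
  by apply: ler_sum => z _; rewrite ler_wpM2l ?lsrw_ge0.
by apply: ler_sum_fsubset => [|z]; rewrite ?fsubsetUr // mulr_ge0 ?lsrw_ge0 ?heat_kernel_ge0.
Qed.

(** The walk cannot notice the killing before it has had time to leave. *)
Lemma killed_heat_kernel B t x y :
  (forall z, (gdist G x z <= t)%N -> z \in B) ->
  killed B t x y = heat_kernel G t x y.
Proof.
elim: t x => [|t IH] x xB; first by rewrite /= xB ?gdistxx // mul1r.
have xxB : x \in B by rewrite xB ?gdistxx.
rewrite killedS // (@heat_kernelS B) //; last first.
  by apply/fsubsetP => z; rewrite in_nbrs // => /(gdist_adj conn) xz; apply: xB; lia.
apply: eq_big_seq => z zB; rewrite /lsrw /srw.
case: eqP => [<-|_]; first by rewrite IH // => w xw; apply: xB; lia.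
case: ifP => [xz|_]; last by rewrite addr0 mulr0 !mul0r.
rewrite IH // => w zw; apply: xB.
by have := gdist_triangle conn z x w; have := gdist_adj conn xz; lia.
Qed.

End Killed.

(** * Heat kernel bounds *)

(** With a symmetric weight, a double sum only sees the symmetric part of its
    argument. *)
Lemma ler_sum_symm (I : eqType) (R : realFieldType) (S : seq I) (w F E : I -> I -> R) :
    (forall y z, w y z = w z y) -> (forall y z, 0 <= w y z) ->
    (forall y z, F y z + F z y <= E y z + E z y) ->
  \sum_(y <- S) \sum_(z <- S) w y z * F y z
    <= \sum_(y <- S) \sum_(z <- S) w y z * E y z.
Proof.
move=> wC w0 FE.
have dbl K : \sum_(y <- S) \sum_(z <- S) w y z * K y z *+ 2 =
    \sum_(y <- S) \sum_(z <- S) w y z * (K y z + K z y).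
  transitivity (\sum_(y <- S) \sum_(z <- S) w y z * K y z +
                \sum_(y <- S) \sum_(z <- S) w y z * K z y).
    rewrite [X in _ + X]exchange_big -big_split /=; apply: eq_bigr => y _.
    by rewrite -big_split /=; apply: eq_bigr => z _; rewrite (wC z y) mulr2n.
  rewrite -big_split; apply: eq_bigr => y _.
  by rewrite -big_split; apply: eq_bigr => z _; rewrite mulrDr.
have : \sum_(y <- S) \sum_(z <- S) w y z * F y z *+ 2 <=
       \sum_(y <- S) \sum_(z <- S) w y z * E y z *+ 2.
  rewrite !dbl; apply: ler_sum => y _; apply: ler_sum => z _.
  by rewrite ler_wpM2l.
under eq_bigr do rewrite sumrMnl.
under [leRHS]eq_bigr do rewrite sumrMnl.
by rewrite !sumrMnl ler_pMn2r.
Qed.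

Section Bounds.
Variables (V : choiceType) (G : sgraph V) (R : realType).
Hypotheses (inf : infinite_graph V) (conn : connected_graph G).
Hypothesis bdeg : bounded_degree G.
Implicit Types (x y z w : V) (s t : nat) (H S B : {fset V}).

Local Arguments lsrw {V} G R x y : simpl never.
Local Notation P := (lsrw G R).
Local Notation "'pi' x" := ((deg G x)%:R : R) (at level 10, x at level 8).
Local Notation killed := (@killed V G R).

(** Jensen's inequality for [P u y], an average of the values [(u y + u z) / 2]
    over the edges at [y].  An edge that leaves [H] carries the value [u y / 2],
    whose square is at most [u y ^+ 2], so killing only helps. *)
Lemma lsrw_jensen H (u : V -> R) y : y \in H ->
  pi y * (\sum_(z <- H) P y z * u z) ^+ 2 <=
  pi y * u y ^+ 2 +
    \sum_(z <- H) (adj G y z)%:R * (((u y + u z) / 2) ^+ 2 - u y ^+ 2).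
Proof.
move=> yH; set m := \sum_(z <- H) P y z * u z.
pose s0 : R := \sum_(z <- H) (adj G y z)%:R.
pose s1 := \sum_(z <- H) (adj G y z)%:R * u z.
pose s2 := \sum_(z <- H) (adj G y z)%:R * ((u y + u z) / 2) ^+ 2.
have s0_le : s0 <= pi y by exact: sum_adj_le.
have mE : pi y * m = 2^-1 * (pi y * u y + s1).
  rewrite /m mulr_sumr.
  rewrite (eq_bigr (fun z => 2^-1 * ((y == z)%:R * (pi y * u z) + (adj G y z)%:R * u z))).
    rewrite -mulr_sumr big_split /= big_seq_delta ?fset_uniq // yH mul1r.
    by rewrite /s1.
  by move=> z _; rewrite mulrA deg_lsrw //; ring.
have jensen : 0 <= \sum_(z <- H) (adj G y z)%:R * ((u y + u z) / 2 - m) ^+ 2.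
  by apply: sumr_ge0 => z _; rewrite mulr_ge0 ?sqr_ge0.
have jE : \sum_(z <- H) (adj G y z)%:R * ((u y + u z) / 2 - m) ^+ 2 =
    s2 - m * (u y * s0 + s1) + m ^+ 2 * s0.
  rewrite /s2 /s0 /s1 mulr_sumr -big_split /= mulr_sumr -sumrB mulr_sumr -big_split /=.
  by apply: eq_bigr => z _; field.
have -> : \sum_(z <- H) (adj G y z)%:R * (((u y + u z) / 2) ^+ 2 - u y ^+ 2) =
    s2 - s0 * u y ^+ 2.
  by rewrite /s2 /s0 mulr_suml -sumrB; apply: eq_bigr => z _; ring.
have k1 : 0 <= (pi y - s0) * (u y / 2 - m) ^+ 2 by rewrite mulr_ge0 ?sqr_ge0 ?subr_ge0.
have k2 : 0 <= (pi y - s0) * u y ^+ 2 by rewrite mulr_ge0 ?sqr_ge0 ?subr_ge0.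
rewrite jE in jensen.
have s1E : s1 = 2 * (pi y * m) - pi y * u y by rewrite mE; field.
move: jensen k1 k2; rewrite s1E; move: (pi y) (u y) => d a; nra.
Qed.

(** One step of the walk increases a weighted [l2] norm by at most the gradient
    of the weight: the Dirichlet form absorbs the cross term. *)
Lemma weighted_energy_step H (u phi : V -> R) :
  \sum_(y <- H) pi y * phi y ^+ 2 * (\sum_(z <- H) P y z * u z) ^+ 2 <=
  \sum_(y <- H) pi y * phi y ^+ 2 * u y ^+ 2 +
  \sum_(y <- H) \sum_(z <- H)
     (adj G y z)%:R * (u y ^+ 2 * (phi y - phi z) ^+ 2).
Proof.
pose F y z := phi y ^+ 2 * (((u y + u z) / 2) ^+ 2 - u y ^+ 2).
apply: (@le_trans _ _ (\sum_(y <- H) pi y * phi y ^+ 2 * u y ^+ 2 +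
    \sum_(y <- H) \sum_(z <- H) (adj G y z)%:R * F y z)).
  rewrite -big_split /=; apply: ler_sum_seq => y yH.
  have phiC c : pi y * phi y ^+ 2 * c = phi y ^+ 2 * (pi y * c) by ring.
  rewrite !phiC; apply: le_trans (ler_wpM2l (sqr_ge0 (phi y)) (lsrw_jensen u yH)) _.
  by rewrite mulrDr mulr_sumr lerD2l; apply: ler_sum => z _; rewrite mulrCA.
rewrite lerD2l; apply: ler_sum_symm => [y z|y z|y z]; rewrite ?ler0n //.
  by rewrite adj_sym.
rewrite /F -subr_ge0.
move: (phi y) (phi z) (u y) (u z) => p q a b.
(* The difference of the two sides as a sum of squares. *)
rewrite (_ : _ - _ = 8^-1 * ((p + q) * (a - b) + 2 * (p - q) * (a + b)) ^+ 2 +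
  5 / 8 * ((p - q) * (a - b)) ^+ 2); last by field.
by rewrite addr_ge0 // mulr_ge0 ?sqr_ge0.
Qed.

(** The kernel is a function of its first variable, on which the walk acts, and
    [deg] is the measure for which the walk is self-adjoint. *)
Definition moment H x (j t : nat) : R :=
  \sum_(y <- H) pi y * (gdist G x y)%:R ^+ (2 * j) * killed H t y x ^+ 2.

Lemma moment_ge0 H x j t : 0 <= moment H x j t.
Proof.
apply: sumr_ge0 => y _.
by rewrite !mulr_ge0 ?exprn_ge0 ?killed_ge0.
Qed.

Lemma moment0E H x t : moment H x 0 t = pi x * killed H (t + t) x x.
Proof.
rewrite killedD mulr_sumr; apply: eq_bigr => y _.
by rewrite mulr1 mulrA killed_sym // expr2 mulrA.
Qed.

(** The energy step for the weight [d(x,_) ^ 2], whose gradient along an edge is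
    at most [2 d + 1]. *)
Lemma moment_step H x t :
  moment H x 2 t.+1 <= moment H x 2 t + 8 * moment H x 1 t + 2 * moment H x 0 t.
Proof.
pose phi y : R := (gdist G x y)%:R ^+ 2; pose u y := killed H t y x.
have E s : moment H x 2 s = \sum_(y <- H) pi y * phi y ^+ 2 * killed H s y x ^+ 2.
  by apply: eq_bigr => y _; rewrite -exprM.
rewrite [leLHS]E.
rewrite (eq_big_seq (fun y => pi y * phi y ^+ 2 * (\sum_(z <- H) P y z * u z) ^+ 2)).
  2: by move=> y yH; rewrite killedS.
apply: le_trans (weighted_energy_step _ _ _) _.
rewrite -E -addrA lerD2l !mulr_sumr -big_split /=; apply: ler_sum => y _.
apply: (@le_trans _ _ (\sum_(z <- H) (adj G y z)%:R *
    (u y ^+ 2 * (8 * (gdist G x y)%:R ^+ 2 + 2)))).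
  apply: ler_sum => z _; case: (boolP (adj G y z)) => yz; last by rewrite !mul0r.
  rewrite !mul1r ler_wpM2l ?sqr_ge0 // /phi.
  have := gdist_triangle conn y x z; have := gdist_triangle conn z x y.
  have := gdist_adj conn yz; rewrite (gdist_sym conn z y) => h1 h2 h3.
  have {h2} : (gdist G x y)%:R <= (gdist G x z)%:R + 1 :> R.
    by rewrite natr1 ler_nat; lia.
  have {h1 h3} : (gdist G x z)%:R <= (gdist G x y)%:R + 1 :> R.
    by rewrite natr1 ler_nat; lia.
  have : 0 <= (gdist G x y)%:R :> R by [].
  have : 0 <= (gdist G x z)%:R :> R by [].
  move: (gdist G x y)%:R (gdist G x z)%:R => p q q0 p0 qp pq.
  have pq1 : (p - q) ^+ 2 <= 1 by nra.
  have pq2 : (p + q) ^+ 2 <= 8 * p ^+ 2 + 2.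
    have h1 : 0 <= (p + 1 - q) * (3 * p + 1 + q) by rewrite mulr_ge0; lra.
    have := sqr_ge0 (2 * p - 1); rewrite -subr_ge0; move: h1; nra.
  rewrite (_ : (p ^+ 2 - q ^+ 2) ^+ 2 = (p - q) ^+ 2 * (p + q) ^+ 2); last by ring.
  by apply: le_trans pq2; rewrite ler_piMl ?sqr_ge0.
rewrite -mulr_suml.
apply: (@le_trans _ _ (pi y * (u y ^+ 2 * (8 * (gdist G x y)%:R ^+ 2 + 2)))).
  by rewrite ler_wpM2r ?sum_adj_le // mulr_ge0 ?sqr_ge0 // addr_ge0 // mulr_ge0 ?sqr_ge0.
by rewrite le_eqVlt muln0 muln1 expr0 /u; apply/orP; left; apply/eqP; ring.
Qed.

Lemma moment_interp H x t (l : R) : 0 < l ->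
  2 * moment H x 1 t <= l * moment H x 2 t + l^-1 * moment H x 0 t.
Proof.
move=> l0; rewrite !mulr_sumr -big_split /=; apply: ler_sum => y _.
rewrite muln0 muln1 expr0 -[(2 * 2)%N]/4%N.
have w0 : 0 <= pi y * killed H t y x ^+ 2 by rewrite mulr_ge0 ?sqr_ge0.
have ll : l^-1 * l = 1 by rewrite mulVf ?gt_eqF.
have li : 0 < l^-1 by rewrite invr_gt0.
have : 0 <= l^-1 * (l * (gdist G x y)%:R ^+ 2 - 1) ^+ 2 * (pi y * killed H t y x ^+ 2).
  by rewrite mulr_ge0 // mulr_ge0 ?sqr_ge0 // ltW.
rewrite -subr_ge0; congr (0 <= _).
move: (gdist G x y)%:R (killed H t y x) (pi y) ll => d k p ll.
rewrite (_ : l^-1 * _ = (l^-1 * l) * (l * d ^+ 4) - 2 * (l^-1 * l) * d ^+ 2 + l^-1); last by ring.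
by rewrite ll; ring.
Qed.

Variables (D a : R).
Hypothesis degD : forall x, pi x <= D.
Hypothesis diag : forall H t x, killed H t x x <= a / t.+1%:R.

Local Notation A := (D * a).

Lemma moment0_le H x t : moment H x 0 t <= A / t.+1%:R.
Proof.
have a0 : 0 <= a.
  by have := le_trans (killed_ge0 G R H 0 x x) (diag H 0 x); rewrite divr1.
have D0 : 0 <= D := le_trans (ler0n _ _) (degD x).
rewrite moment0E -mulrA ler_pM ?killed_ge0 //.
apply: le_trans (diag _ _ _) _.
by rewrite ler_wpM2l // lef_pV2 ?posrE // ler_nat; lia.
Qed.

Lemma energy_const_ge0 x : 0 <= A.
Proof.
by have := le_trans (moment_ge0 fset0 x 0 0) (moment0_le fset0 x 0); rewrite divr1.
Qed.

(** The linear growth of the fourth moment.  The recursion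
    [M2 (t+1) <= M2 t + 8 M1 t + 2 M0 t] closes because [M1] is at most the
    geometric mean of [M2 = O(t)] and [M0 = O(1/t)], a bounded quantity. *)
Lemma moment2_le H x t : moment H x 2 t <= 68 * A * t%:R.
Proof.
elim: t => [|t IH].
  rewrite mulr0 /moment big1 // => y _ /=.
  case: (eqVneq y x) => [->|_]; last by rewrite mulr0 expr0n mulr0.
  by rewrite gdistxx // expr0n mulr0 mul0r.
apply: le_trans (moment_step _ _ _) _.
have t1 : 0 < t.+1%:R :> R by [].
(* With weight [l / (t+1)] for [M2] the increment is [4 l M2 / (t+1) + ...], and
   [l = 1/8] makes it half of the constant that is being propagated. *)
have l0 : 0 < 8^-1 / t.+1%:R :> R by rewrite divr_gt0.
have := moment_interp H x t l0; have := moment0_le H x t.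
have := energy_const_ge0 x; have := moment_ge0 H x 0 t; have := moment_ge0 H x 2 t.
move: (moment H x 0 t) (moment H x 1 t) (moment H x 2 t) IH => m0 m1 m2 IH p2 p0 A0 le0.
rewrite invf_div invrK => le1.
have le0' : t.+1%:R * m0 <= A by rewrite mulrC -ler_pdivlMr.
have m0A : m0 <= A.
  apply: le_trans le0' ; rewrite -[leLHS]mul1r ler_wpM2r // ler1n //.
have le2 : 8^-1 / t.+1%:R * m2 <= 8^-1 * (68 * A).
  rewrite -mulrA ler_wpM2l // mulrC ler_pdivrMr //.
  by apply: le_trans IH _; rewrite ler_wpM2l ?ler_nat // mulr_ge0.
have le3 : t.+1%:R * 8 * m0 <= 8 * A by rewrite mulrAC [_ * 8]mulrC ler_wpM2l.
have -> : 68 * A * t.+1%:R = 68 * A * t%:R + 68 * A by rewrite -[in LHS]natr1; ring.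
move: (8^-1 / _ * m2) (t.+1%:R * 8 * m0) le1 le2 le3 => u v le1 le2 le3.
lra.
Qed.

Lemma killed_convolution H s t x y :
  pi x * killed H (s + t) x y = \sum_(z <- H) pi z * killed H s z x * killed H t z y.
Proof.
rewrite killedD mulr_sumr; apply: eq_bigr => z _.
by rewrite mulrA killed_sym.
Qed.

Lemma half_split n : exists s t, [/\ n = s + t, s <= t & t <= s.+1]%N.
Proof. by exists n./2, (n - n./2)%N; rewrite -divn2; split; lia. Qed.

Lemma deg_ge1 x : 1 <= pi x.
Proof. by rewrite ler1n deg_gt0. Qed.

(** Splitting the time in two halves, the convolution is at most the mean of two
    squared norms, each equal to [deg] times a diagonal value of the kernel. *)
Lemma killed_le_time H n x y : killed H n x y <= 2 * A / n.+1%:R.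
Proof.
have [s [t [-> st ts]]] := half_split n.
apply: (@le_trans _ _ (pi x * killed H (s + t) x y)).
  by rewrite ler_peMl ?killed_ge0 // deg_ge1.
rewrite killed_convolution.
apply: (@le_trans _ _ (2^-1 * (moment H x 0 s + moment H y 0 t))).
  rewrite -big_split mulr_sumr; apply: ler_sum => z _ /=.
  rewrite !mulr1.
  have := deg_ge1 z; move: (pi z) (killed H s z x) (killed H t z y) => p u v p1.
  rewrite -subr_ge0 (_ : _ - _ = 2^-1 * p * (u - v) ^+ 2); last by field.
  by rewrite mulr_ge0 ?sqr_ge0 //; lra.
have A0 := energy_const_ge0 x.
have le s' : (s + t <= s'.*2.+1)%N -> A / s'.+1%:R <= 2 * A / (s + t).+1%:R.
  move=> ss; rewrite ler_pdivlMr // mulrAC ler_pdivrMr //.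
  rewrite (_ : 2 * A * s'.+1%:R = A * (2 * s'.+1)%:R); last by rewrite natrM; ring.
  by rewrite ler_wpM2l // ler_nat; lia.
have := moment0_le H x s; have := moment0_le H y t.
have lt : A / t.+1%:R <= 2 * A / (s + t).+1%:R by apply: le; lia.
have ls : A / s.+1%:R <= 2 * A / (s + t).+1%:R by apply: le; lia.
move: (2 * A / _) (A / _) (A / _) ls lt => b c d; lra.
Qed.

(** In the convolution over the midpoint [z] one of [d(x,z)], [d(z,y)] is at
    least [d(x,y) / 2].  By the arithmetic-geometric inequality the square of
    that distance is paid for by a fourth moment, [O(t)], divided by [t], and by
    [t] times a squared norm, [O(1/t)]. *)
Lemma killed_le_dist H n x y :
  killed H n x y * (gdist G x y)%:R ^+ 2 <= 138 * A.
Proof.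
have [s [t [-> st ts]]] := half_split n.
apply: (@le_trans _ _ (pi x * killed H (s + t) x y * (gdist G x y)%:R ^+ 2)).
  by rewrite ler_wpM2r ?sqr_ge0 // ler_peMl ?killed_ge0 // deg_ge1.
rewrite killed_convolution.
apply: (@le_trans _ _ (t.+1%:R^-1 * moment H x 2 s + t.+1%:R * moment H y 0 t +
                       (s.+1%:R^-1 * moment H y 2 t + s.+1%:R * moment H x 0 s))).
  rewrite !mulr_sumr -!big_split mulr_suml; apply: ler_sum => z _ /=.
  rewrite !mulr1 -[(2 * 2)%N]/4%N.
  have tri : (gdist G x y)%:R <= (gdist G x z)%:R + (gdist G y z)%:R :> R.
    by rewrite -natrD ler_nat (gdist_sym conn y z) gdist_triangle.
  have d0 : 0 <= (gdist G x y)%:R :> R by [].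
  have {tri d0} d2 : (gdist G x y)%:R ^+ 2 <=
      2 * (gdist G x z)%:R ^+ 2 + 2 * (gdist G y z)%:R ^+ 2 :> R.
    move: (gdist G x y)%:R (gdist G x z)%:R (gdist G y z)%:R tri d0 => r p q tri r0.
    have rpq : r ^+ 2 <= (p + q) ^+ 2 by rewrite ler_sqr ?nnegrE //; lra.
    have := sqr_ge0 (p - q); move: rpq; nra.
  apply: (@le_trans _ _ (pi z * killed H s z x * killed H t z y *
      (2 * (gdist G x z)%:R ^+ 2 + 2 * (gdist G y z)%:R ^+ 2))).
    by rewrite ler_wpM2l // !mulr_ge0 ?killed_ge0.
  have amgm (l e u v : R) : 0 < l -> 0 <= e ->
      2 * e * u * v <= l^-1 * (e ^+ 2 * u ^+ 2) + l * v ^+ 2.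
    move=> l0 e0; rewrite -subr_ge0.
    rewrite (_ : _ - _ = l^-1 * (e * u - l * v) ^+ 2); last by field; rewrite gt_eqF.
    by rewrite mulr_ge0 ?sqr_ge0 ?invr_ge0 // ltW.
  have := amgm t.+1%:R ((gdist G x z)%:R ^+ 2) (killed H s z x) (killed H t z y).
  have := amgm s.+1%:R ((gdist G y z)%:R ^+ 2) (killed H t z y) (killed H s z x).
  rewrite -!exprM !ltr0n !exprn_ge0 // => /(_ isT isT) h1 /(_ isT isT) h2.
  have := ler_wpM2l (ler0n R (deg G z)) (lerD h2 h1).
  by congr (_ <= _); ring.
have A0 := energy_const_ge0 x.
have m0 w r : r.+1%:R * moment H w 0 r <= A by rewrite mulrC -ler_pdivlMr // moment0_le.
have m2 w r q : (r <= q.+1)%N -> q.+1%:R^-1 * moment H w 2 r <= 68 * A.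
  move=> rq; rewrite mulrC ler_pdivrMr //; apply: le_trans (moment2_le _ _ _) _.
  by rewrite ler_wpM2l ?ler_nat // mulr_ge0.
have := lerD (lerD (m2 x s t (leq_trans st (leqnSn t))) (m0 y t))
             (lerD (m2 y t s ts) (m0 x s)).
by move=> /le_trans; apply; lra.
Qed.

End Bounds.

(** * Thin annuli have small volume *)

(** On the block [4^m <= j < 4^(m+1)] the sum is at most [3 F (4^(m+1))], which
    the growth hypothesis at [4^m] turns into [3 (K + 1)] times the increment of
    [F] across the block; increments telescope.  The last block, which reaches
    beyond [rho], contributes at most [3 N]. *)
Lemma log_sum_le (R : realFieldType) (F : nat -> R) (K N : R) (rho : nat) :
    {homo F : i j / (i <= j)%N >-> i <= j} -> 0 <= F 0%N -> (forall j, F j <= N) ->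
    0 <= K -> (0 < rho)%N ->
    (forall j, (0 < j)%N -> (3 * j <= rho)%N -> F j <= K * (F (4 * j)%N - F j)) ->
  \sum_(1 <= j < rho.+1) F j / j%:R <= 3 * (K + 2) * N.
Proof.
move=> Fhomo F00 FN K0 rho0 Fgrow.
have F0 j : 0 <= F j by apply: le_trans (Fhomo _ _ (leq0n j)).
have block m : \sum_(4 ^ m <= j < 4 ^ m.+1) F j / j%:R <= 3 * F (4 ^ m.+1)%N.
  have m0 : (0 < 4 ^ m)%N by rewrite expn_gt0.
  apply: (@le_trans _ _ (\sum_(4 ^ m <= j < 4 ^ m.+1) F (4 ^ m.+1)%N / (4 ^ m)%:R)).
    rewrite !big_nat; apply: ler_sum => j /andP[mj jm].
    apply: ler_pM; rewrite ?invr_ge0 // ?Fhomo // 1?ltnW //.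
    by rewrite lef_pV2 ?posrE ?ltr0n ?ler_nat // (leq_trans m0).
  rewrite big_const_nat iter_addr_0 -[_ *+ _]mulr_natr.
  rewrite (_ : (4 ^ m.+1 - 4 ^ m)%N = (3 * 4 ^ m)%N); last by rewrite expnS; lia.
  rewrite natrM le_eqVlt; apply/orP; left; apply/eqP; field.
  by rewrite pnatr_eq0 -lt0n.
have low m : (4 ^ m <= rho)%N ->
    \sum_(1 <= j < 4 ^ m) F j / j%:R <= 3 * (K + 1) * (F (4 ^ m)%N - F 1%N).
  elim: m => [|m IH] mr; first by rewrite expn0 big_geq // subrr mulr0.
  have m0 : (0 < 4 ^ m)%N by rewrite expn_gt0.
  have mm : (4 ^ m <= 4 ^ m.+1)%N by rewrite leq_exp2l.
  rewrite (big_cat_nat (n := 4 ^ m)) //=.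
  have {}IH := IH (leq_trans mm mr).
  have := Fgrow (4 ^ m)%N m0; rewrite -expnS => h.
  have {}h : F (4 ^ m)%N <= K * (F (4 ^ m.+1)%N - F (4 ^ m)%N).
    by apply: h; move: mr; rewrite expnS; lia.
  have := block m; lra.
have m1 := trunc_logP (isT : (1 < 4)%N) rho0.
have m2 := trunc_log_ltn rho (isT : (1 < 4)%N).
set m := trunc_log 4 rho in m1 m2.
apply: (@le_trans _ _ (\sum_(1 <= j < 4 ^ m.+1) F j / j%:R)).
  rewrite [leRHS](big_cat_nat (n := rho.+1)) //= lerDl sumr_ge0 // => j _.
  by rewrite mulr_ge0 ?invr_ge0.
rewrite (big_cat_nat (n := 4 ^ m)) ?expn_gt0 ?leq_exp2l //=.
have := low m m1; have := block m; have := FN (4 ^ m.+1)%N; have := FN (4 ^ m)%N.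
have := F0 1%N; have : 0 <= F (4 ^ m)%N by [].
move: (F _) (F 1%N) (F (_ ^ _)%N) (bigop.body _ _ _) (bigop.body _ _ _) => b c d e f.
nra.
Qed.

Section Annulus.
Variables (V : choiceType) (G : sgraph V) (R : realType).
Hypotheses (conn : connected_graph G) (bdeg : bounded_degree G).
Implicit Types (x y z w v : V) (k : nat).

Local Notation ball x k := (gball G x (k%:R : R)).

Lemma sum_mem_le (S T : {fset V}) :
  \sum_(x <- T) (x \in S)%:R <= (#|` S|)%:R :> R.
Proof.
rewrite -natr_sum ler_nat -big_mkcond sum1_count -size_filter.
apply: uniq_leq_size; first by rewrite filter_uniq ?fset_uniq.
by move=> z; rewrite mem_filter => /andP[].
Qed.

Lemma card_le_sum_mem (S T : {fset V}) : (S `<=` T)%fset ->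
  (#|` S|)%:R <= \sum_(x <- T) (x \in S)%:R :> R.
Proof.
move=> ST; apply: (@le_trans _ _ (\sum_(x <- S) (x \in S)%:R)).
  by rewrite -sum1_size natr_sum; apply: ler_sum_seq => x ->.
exact: ler_sum_fsubset.
Qed.

Definition annulus x0 rho k : {fset V} :=
  [fset x in ball x0 rho | (rho < gdist G x0 x + k)%N]%fset.

Lemma in_annulus x0 rho k x :
  (x \in annulus x0 rho k) = (gdist G x0 x <= rho < gdist G x0 x + k)%N.
Proof. by rewrite !inE /= in_gball. Qed.

Variables c1 c2 : R.
Hypotheses (c1_gt0 : 0 < c1) (c2_gt0 : 0 < c2).
Hypothesis vol : forall x k, (0 < k)%N ->
  c1 * k%:R ^+ 2 <= (#|` ball x k|)%:R <= c2 * k%:R ^+ 2.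

(** Each [x] in the annulus of width [k] is moved by [2 k] towards the centre
    along a geodesic; the ball of radius [k] around the result lies in the
    annulus of width [4 k] but outside that of width [k], and a given point
    lies in the balls of at most [9 c2 k ^+ 2] many [x]. *)
Lemma annulus_growth x0 rho k : (0 < k)%N -> (3 * k <= rho)%N ->
  (#|` annulus x0 rho k|)%:R <=
  9 * c2 / c1 * ((#|` annulus x0 rho (4 * k)|)%:R - (#|` annulus x0 rho k|)%:R).
Proof.
move=> k0 k3.
have /choice[w wP] : forall x, exists w, (2 * k <= gdist G x0 x)%N ->
    (gdist G w x <= 2 * k)%N /\ (gdist G x0 w + 2 * k = gdist G x0 x)%N.
  move=> x; case: (leqP (2 * k) (gdist G x0 x)) => [kx|_]; last by exists x.
  by have [w wx wE] := gdist_between conn kx; exists w.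
pose E := (annulus x0 rho (4 * k) `\` annulus x0 rho k)%fset.
have EE : (#|` E|)%:R = (#|` annulus x0 rho (4 * k)|)%:R - (#|` annulus x0 rho k|)%:R :> R.
  have sub : (annulus x0 rho k `<=` annulus x0 rho (4 * k))%fset.
    by apply/fsubsetP => x; rewrite !in_annulus; lia.
  by rewrite cardfsD (fsetIidPr sub) natrB // fsubset_leq_card.
rewrite -EE.
have far x : x \in annulus x0 rho k -> (2 * k <= gdist G x0 x)%N.
  by rewrite in_annulus; lia.
have sub x : x \in annulus x0 rho k -> (ball (w x) k `<=` E)%fset.
  move=> xA; have [wx wE] := wP x (far x xA).
  apply/fsubsetP => v; rewrite in_fsetD !in_annulus in_gball // => wv.
  move: xA; rewrite in_annulus.
  have := gdist_triangle conn (w x) x0 v; have := gdist_triangle conn v x0 (w x).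
  by rewrite (gdist_sym conn v); lia.
have k2 : 0 < k%:R ^+ 2 :> R by rewrite exprn_gt0 // ltr0n.
have count : c1 * k%:R ^+ 2 * (#|` annulus x0 rho k|)%:R <=
    (#|` E|)%:R * (c2 * (3 * k)%:R ^+ 2).
  apply: (@le_trans _ _ (\sum_(x <- annulus x0 rho k) (#|` ball (w x) k|)%:R)).
    rewrite -sum1_size natr_sum mulr_sumr; apply: ler_sum => x _.
    by rewrite mulr1; case/andP: (vol (w x) k0).
  apply: (@le_trans _ _ (\sum_(x <- annulus x0 rho k) \sum_(v <- E)
      (v \in ball (w x) k)%:R)).
    by apply: ler_sum_seq => x xA; rewrite card_le_sum_mem ?sub.
  rewrite exchange_big -[X in _ <= X%:R * _]sum1_size natr_sum mulr_suml.
  apply: ler_sum => v _; rewrite mul1r.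
  have k30 : (0 < 3 * k)%N by lia.
  case/andP: (vol v k30) => _; apply: le_trans.
  apply: le_trans (sum_mem_le (ball v (3 * k)) (annulus x0 rho k)).
  apply: ler_sum_seq => x xA; rewrite ler_nat !in_gball //.
  have [wx wE] := wP x (far x xA); have := gdist_triangle conn (w x) v x.
  rewrite (gdist_sym conn v (w x)); case: leqP => //= wv; case: leqP => //; lia.
rewrite -(ler_pM2l (mulr_gt0 c1_gt0 k2)); apply: le_trans count _.
by rewrite le_eqVlt natrM; apply/orP; left; apply/eqP; field; rewrite gt_eqF.
Qed.

Lemma annulus_sum_le x0 rho : (0 < rho)%N ->
  \sum_(1 <= j < rho.+1) (#|` annulus x0 rho j|)%:R / j%:R <=
  3 * (9 * c2 / c1 + 2) * (#|` ball x0 rho|)%:R.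
Proof.
move=> rho0; apply: (log_sum_le (F := fun j => (#|` annulus x0 rho j|)%:R)) => //.
- move=> i j ij; rewrite ler_nat fsubset_leq_card //.
  by apply/fsubsetP => x; rewrite !in_annulus; lia.
- by move=> j; rewrite ler_nat fsubset_leq_card // fset_sub.
- by rewrite divr_ge0 ?mulr_ge0 // ltW.
- by move=> j; apply: annulus_growth.
Qed.

End Annulus.

(** * The Green function of a finite set *)

Section Green.
Variables (V : choiceType) (G : sgraph V) (R : realType).
Hypotheses (inf : infinite_graph V) (conn : connected_graph G).
Hypothesis bdeg : bounded_degree G.
Implicit Types (x y z w : V) (s t : nat).

Local Arguments lsrw {V} G R x y : simpl never.
Local Notation P := (lsrw G R).
Local Notation killed := (@killed V G R).

Variables (H : {fset V}) (T : nat).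
Hypothesis half : forall x, \sum_(y <- H) killed H T x y <= 2^-1.

(** Half of the mass being killed in [T] steps is a quantitative maximum
    principle: a negative minimum would have to be at least half of itself. *)
Lemma killed_supersolution_ge0 (v : V -> R) :
    (forall x, x \in H -> \sum_(z <- H) killed H T x z * v z <= v x) ->
  forall x, x \in H -> 0 <= v x.
Proof.
move=> vT x xH.
case: (@arg_minP _ _ H [` xH]%fset predT (v \o val) isT) => m _ mmin.
have {}mmin z : z \in H -> v (val m) <= v z.
  by move=> zH; have := mmin [` zH]%fset isT.
apply: le_trans (mmin x xH); rewrite leNgt; apply/negP => m0.
have : v (val m) * 2^-1 <= v (val m).
  apply: le_trans (vT _ (valP m)).
  apply: (@le_trans _ _ (v (val m) * \sum_(z <- H) killed H T (val m) z)).
    by rewrite ler_wnM2l // ltW.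
  rewrite mulr_sumr; apply: ler_sum_seq => z zH.
  by rewrite mulrC ler_wpM2l ?killed_ge0 ?mmin.
lra.
Qed.

Lemma supersolution_ge0 (v : V -> R) :
    (forall x, x \in H -> \sum_(z <- H) P x z * v z <= v x) ->
  forall x, x \in H -> 0 <= v x.
Proof.
move=> vP; apply: killed_supersolution_ge0.
elim: T => [|t IH] x xH.
  rewrite (eq_bigr (fun z => (x == z)%:R * v z)); last by move=> z _; rewrite /= xH mul1r.
  by rewrite big_seq_delta ?fset_uniq // xH mul1r.
apply: le_trans (vP x xH).
rewrite (eq_bigr (fun z => \sum_(w <- H) P x w * (killed H t w z * v z))).
  rewrite exchange_big; apply: ler_sum_seq => w wH.
  by rewrite -mulr_sumr ler_wpM2l ?lsrw_ge0 ?IH.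
by move=> z _; rewrite killedS // mulr_suml; apply: eq_bigr => w _; rewrite mulrA.
Qed.

Definition is_green (g : V -> V -> R) : Prop :=
  forall x y, x \in H -> y \in H ->
    g x y = (x == y)%:R + \sum_(z <- H) P x z * g z y.

Lemma zeta1_green :
  exists2 g, is_green g & zeta1 G R H = \sum_(x <- H) g x x.
Proof.
pose vt (i : 'I_#|{: H}|) : V := val (enum_val i).
have vt_inj : injective vt by move=> i j /val_inj /enum_val_inj.
have vtH i : vt i \in H by rewrite /vt; apply: valP.
have sumE (F : V -> R) : \sum_(x <- H) F x = \sum_i F (vt i).
  by rewrite big_seq_fsetE /= -(big_enum_val (fun x : H => F (val x))).
have onto x : x \in H -> exists i, x = vt i.
  move=> xH; have xT : [` xH]%fset \in {: H} by [].
  by exists (enum_rank_in xT [` xH]%fset); rewrite /vt enum_rankK_in.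
(* A vector indexed by ordinals, transported to a function on [V]. *)
pose ext (c : 'I_#|{: H}| -> R) x := \sum_i c i * (vt i == x)%:R.
have extE c i : ext c (vt i) = c i.
  rewrite /ext (bigD1 i) //= eqxx mulr1 big1 ?addr0 // => j ji.
  by rewrite (inj_eq vt_inj) (negbTE ji) mulr0.
pose L := dirichlet G R H.
have LE c i : \sum_j L i j * c j = c i - \sum_(z <- H) P (vt i) z * ext c z.
  rewrite sumE (eq_bigr (fun j => (i == j)%:R * c j - P (vt i) (vt j) * ext c (vt j))).
    rewrite sumrB; congr (_ - _); rewrite (bigD1 i) //= eqxx mul1r big1 ?addr0 // => j.
    by rewrite eq_sym => /negbTE ->; rewrite mul0r.
  by move=> j _; rewrite mxE /= -/(vt i) -/(vt j) (inj_eq vt_inj) extE mulrBl.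
have Lu : L \in unitmx.
  rewrite -unitmx_tr -row_free_unit; apply: inj_row_free => c cL.
  pose v := ext (c 0).
  have vE x : x \in H -> v x = \sum_(z <- H) P x z * v z.
    move=> /onto[i ->]; apply/eqP; rewrite -subr_eq0 {1}/v extE -LE.
    have := congr1 (fun M : 'rV_ _ => M 0 i) cL; rewrite !mxE => cL0.
    apply/eqP/(etrans _ cL0); by apply: eq_bigr => j _; rewrite [in RHS]mxE mulrC.
  apply/rowP => i; rewrite mxE -(extE (c 0) i) -/v.
  apply: le_anti; apply/andP; split; last by apply: supersolution_ge0 => // x /vE <-.
  rewrite -oppr_ge0; apply: (supersolution_ge0 (v := fun x => - v x)) => // x /vE vx.
  by rewrite [X in _ <= - X]vx -sumrN; apply: ler_sum => z _; rewrite mulrN.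
pose g x y := \sum_j ext (fun i => invmx L i j) x * (vt j == y)%:R.
have gE x j : g x (vt j) = ext (fun i => invmx L i j) x.
  rewrite /g (bigD1 j) //= eqxx mulr1 big1 ?addr0 // => k kj.
  by rewrite (inj_eq vt_inj) (negbTE kj) mulr0.
exists g; last by rewrite sumE; apply: eq_bigr => i _; rewrite gE extE.
move=> x y /onto[i ->] /onto[j ->].
have := congr1 (fun M : 'M[R]_(#|{: H}|) => M i j) (mulmxV Lu); rewrite !mxE LE => LM.
rewrite gE extE (inj_eq vt_inj) -LM (eq_bigr (fun z => P (vt i) z * g z (vt j))); first by rewrite subrK.
by move=> z _; rewrite gE.
Qed.

Lemma green_iter g t x y : is_green g -> x \in H -> y \in H ->
  g x y = \sum_(0 <= s < t) killed H s x y + \sum_(z <- H) killed H t x z * g z y.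
Proof.
move=> gG; elim: t x => [|t IH] x xH yH.
  rewrite big_geq // add0r (eq_bigr (fun z => (x == z)%:R * g z y)).
    by rewrite big_seq_delta ?fset_uniq // xH mul1r.
  by move=> z _; rewrite /= xH mul1r.
rewrite big_nat_recl //= xH mul1r (gG x y) // -addrA; congr (_ + _).
rewrite (eq_big_seq (fun z => \sum_(0 <= s < t) P x z * killed H s z y +
    \sum_(w <- H) P x z * (killed H t z w * g w y))); last first.
  by move=> z zH; rewrite (IH z) // mulrDr !mulr_sumr.
rewrite big_split /=; congr (_ + _).
  rewrite exchange_big; apply: eq_bigr => s _; by rewrite mul1r.
rewrite exchange_big; apply: eq_bigr => w _.
by rewrite mul1r mulr_suml; apply: eq_bigr => z _; rewrite mulrA.
Qed.

Lemma green_ge0 g x y : is_green g -> x \in H -> y \in H -> 0 <= g x y.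
Proof.
move=> gG xH yH; apply: (supersolution_ge0 (v := g^~ y)) => // {}x {}xH.
by rewrite (gG x y) // lerDr.
Qed.

(** A row sum is an expected exit time [h].  Within [T] steps the clock advances
    by at most [T] and half of the mass is lost, so [2 T - h] is a supersolution
    for [T] steps. *)
Lemma green_sum_le g x : is_green g -> x \in H ->
  \sum_(y <- H) g x y <= 2 * T%:R.
Proof.
move=> gG xH; rewrite -subr_ge0.
apply: (killed_supersolution_ge0 (v := fun x => 2 * T%:R - \sum_(y <- H) g x y)) => // {}x {}xH.
rewrite (eq_bigr (fun z => 2 * T%:R * killed H T x z - \sum_(y <- H) killed H T x z * g z y)).
  2: by move=> z _; rewrite mulrBr mulr_sumr mulrC.
rewrite sumrB exchange_big /= -mulr_sumr.
rewrite [X in _ <= _ - X](eq_big_seq (fun y => \sum_(0 <= s < T) killed H s x y +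
    \sum_(z <- H) killed H T x z * g z y)); last first.
  by move=> y yH; apply: green_iter.
rewrite big_split /= opprD addrA lerD2r exchange_big /=.
have : \sum_(0 <= s < T) \sum_(y <- H) killed H s x y <= T%:R.
  apply: (@le_trans _ _ (\sum_(0 <= s < T) 1)).
    by apply: ler_sum => s _; apply: killed_sum_le1.
  by rewrite sumr_const_nat subn0.
have T0 : 0 <= T%:R :> R by [].
have := half x; move: (\sum_(_ <- _) _) (\sum_(_ <= _ < _) _) => a b; nra.
Qed.

Lemma zeta1_bounds b : (forall x y, killed H T x y <= b) ->
  \sum_(x <- H) \sum_(0 <= s < T) killed H s x x <= zeta1 G R H <=
  \sum_(x <- H) \sum_(0 <= s < T) killed H s x x + 2 * T%:R * b * (#|` H|)%:R.
Proof.
move=> Tb; have [g gG ->] := zeta1_green.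
rewrite (eq_big_seq (F1 := fun x => g x x) (fun x => \sum_(0 <= s < T) killed H s x x +
  \sum_(z <- H) killed H T x z * g z x)); last by move=> x xH; apply: green_iter.
rewrite big_split /= lerDl lerD2l; apply/andP; split.
  apply: sumr_ge0_seq => x xH; apply: sumr_ge0_seq => z zH.
  by rewrite mulr_ge0 ?killed_ge0 ?green_ge0.
rewrite exchange_big /= -sum1_size natr_sum mulr_sumr; apply: ler_sum_seq => z zH.
apply: (@le_trans _ _ (\sum_(x <- H) b * g z x)).
  by apply: ler_sum_seq => x xH; rewrite ler_wpM2r ?green_ge0.
rewrite -mulr_sumr mulr1 mulrC ler_wpM2r ?green_sum_le //.
exact: le_trans (killed_ge0 G R H T z z) (Tb z z).
Qed.

End Green.

(** * The boundary contribution *)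

Section TimeSums.
Variable R : realType.

Lemma sum_nat_le_const (F : nat -> R) m n c : 0 <= c ->
    (forall t, (m <= t < n)%N -> F t <= c) ->
  \sum_(m <= t < n) F t <= (n - m)%:R * c.
Proof.
move=> c0 Fc; apply: (@le_trans _ _ (\sum_(m <= t < n) c)).
  by rewrite !big_nat; apply: ler_sum.
by rewrite sumr_const_nat mulr_natl.
Qed.

(** The block [j ^ 2 <= t < (j + 1) ^ 2] has [2 j + 1] terms of size at most
    [1 / j ^ 2]. *)
Lemma harmonic_squares_le r n : (0 < r)%N -> (r <= n)%N ->
  \sum_(r ^ 2 <= t < n ^ 2) t.+1%:R^-1 <= 3 * \sum_(r <= j < n) j%:R^-1 :> R.
Proof.
move=> r0 rn; elim: n rn => [|n IH] rn; first by rewrite !big_geq ?mulr0 // leqn0 sqrn_eq0 -leqn0.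
move: rn; rewrite leq_eqVlt => /orP[/eqP <-|]; first by rewrite !big_geq ?mulr0.
rewrite ltnS => rn; have n0 : (0 < n)%N := leq_trans r0 rn.
rewrite [X in _ <= 3 * X]big_nat_recr //= mulrDr (big_cat_nat (n := n ^ 2)) /= ?leq_sqr //.
rewrite lerD ?IH //; apply: le_trans (sum_nat_le_const (c := (n ^ 2)%:R^-1) _ _) _.
- by rewrite invr_ge0.
- move=> t /andP[nt _]; rewrite lef_pV2 ?posrE ?ltr0n ?sqrn_gt0 // ler_nat.
  exact: leq_trans nt _.
rewrite ler_pdivrMr ?ltr0n ?sqrn_gt0 // mulrAC ler_pdivlMr ?ltr0n //.
by rewrite -!natrM ler_nat !expnS expn0; nia.
Qed.

(** The two heat kernel bounds together: the spatial one is used up to time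
    [r ^ 2], the temporal one after it. *)
Lemma time_sum_le (F : nat -> R) (a b : R) (r n T : nat) :
    (0 < r <= n)%N -> 0 <= a -> 0 <= b -> (forall t, F t <= a / t.+1%:R) ->
    (forall t, F t * r%:R ^+ 2 <= b) ->
  \sum_(0 <= t < T) F t <=
  b + a * (T%:R / n%:R ^+ 2 + 3 * \sum_(r <= j < n) j%:R^-1).
Proof.
move=> /andP[r0 rn] a0 b0 Fa Fb.
have n0 : (0 < n)%N := leq_trans r0 rn.
have rn2 : (r ^ 2 <= n ^ 2)%N by rewrite leq_sqr.
pose W t : R := if (t < r ^ 2)%N then b / (r ^ 2)%:R else a / t.+1%:R.
have W0 t : 0 <= W t by rewrite /W; case: ifP => _; rewrite divr_ge0.
have FW t : F t <= W t.
  rewrite /W; case: ifP => // _.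
  by rewrite natrX ler_pdivlMr // exprn_gt0 // ltr0n.
apply: (@le_trans _ _ (\sum_(0 <= t < maxn T (n ^ 2)) W t)).
  rewrite (big_cat_nat (n := T) (p := maxn _ _)) ?leq_maxl //=.
  by rewrite -[leLHS]addr0 lerD ?sumr_ge0 // ler_sum.
rewrite (big_cat_nat (n := r ^ 2)) //=; last by rewrite (leq_trans rn2) // leq_maxr.
apply: lerD.
  apply: le_trans (sum_nat_le_const (c := b / (r ^ 2)%:R) _ _) _.
  - by rewrite divr_ge0.
  - by move=> t /andP[_ tr]; rewrite /W tr.
  by rewrite subn0 mulrC divfK // pnatr_eq0 -lt0n sqrn_gt0.
rewrite big_nat (eq_bigr (fun t => a * t.+1%:R^-1)); last first.
  by move=> t /andP[rt _]; rewrite /W ltnNge rt.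
rewrite -big_nat -mulr_sumr ler_wpM2l // (big_cat_nat (n := n ^ 2)) ?leq_maxr //= addrC.
rewrite lerD ?harmonic_squares_le //.
apply: le_trans (sum_nat_le_const (c := (n ^ 2)%:R^-1) _ _) _.
- by rewrite invr_ge0.
- move=> t /andP[nt _]; rewrite lef_pV2 ?posrE ?ltr0n ?sqrn_gt0 // ler_nat.
  exact: leq_trans nt _.
by rewrite natrX ler_wpM2r ?invr_ge0 ?exprn_ge0 // ler_nat; lia.
Qed.

End TimeSums.

Section Deficit.
Variables (V : choiceType) (G : sgraph V) (R : realType).
Hypotheses (inf : infinite_graph V) (conn : connected_graph G).
Hypothesis bdeg : bounded_degree G.
Implicit Types (x y z w : V) (s t T : nat) (H B : {fset V}).

Local Arguments lsrw {V} G R x y : simpl never.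
Local Notation P := (lsrw G R).
Local Notation killed := (@killed V G R).
Local Notation ball x k := (gball G x (k%:R : R)).

(** Until the walk leaves [H] the two kernels agree, so their accumulated
    difference at [w] is what the walk in [B] collects there after the exit; a
    bound at all exit points is averaged, hence preserved, by the steps inside
    [H]. *)
Lemma killing_deficit_le H B T w M : (H `<=` B)%fset -> 0 <= M ->
    (forall y, y \in B -> y \notin H -> \sum_(0 <= t < T) killed B t y w <= M) ->
  forall x, \sum_(0 <= t < T) (killed B t x w - killed H t x w) <= M.
Proof.
move=> HB M0; elim: T => [|T IH] yM x; first by rewrite big_geq.
have {}IH : forall z, \sum_(0 <= t < T) (killed B t z w - killed H t z w) <= M.
  apply: IH => y yB yH; apply: le_trans (yM y yB yH).
  by rewrite big_nat_recr //= lerDl killed_ge0.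
case: (boolP (x \in H)) => xH; last first.
  rewrite (eq_bigr (fun t => killed B t x w)).
    case: (boolP (x \in B)) => xB; first exact: yM.
    by rewrite big1 // => t _; rewrite killed_outl.
  by move=> t _; rewrite [killed H _ _ _]killed_outl // subr0.
have xB := fsubsetP HB _ xH.
have k0 S : x \in S -> killed S 0 x w = (x == w)%:R by move=> /= ->; rewrite mul1r.
rewrite big_nat_recl // !k0 // subrr add0r.
rewrite (eq_bigr (fun t => \sum_(z <- B) P x z * (killed B t z w - killed H t z w))).
  rewrite exchange_big /=.
  apply: (@le_trans _ _ (\sum_(z <- B) P x z * M)).
    by apply: ler_sum => z _; rewrite -mulr_sumr ler_wpM2l ?lsrw_ge0.
  by rewrite -mulr_suml ler_piMl ?lsrw_sum_le1.
move=> t _; rewrite !killedS // (sum_fsubset _ HB) -sumrB; apply: eq_bigr => z _.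
rewrite mulrBr; congr (_ - _); case: (boolP (z \in H)) => zH; first by rewrite mul1r.
by rewrite killed_outl // !mulr0.
Qed.

Variables A C : R.
Hypotheses (A_ge0 : 0 <= A) (C_ge0 : 0 <= C).
Hypothesis time_bound : forall H n x y, killed H n x y <= A / n.+1%:R.
Hypothesis dist_bound : forall H n x y,
  killed H n x y * (gdist G x y)%:R ^+ 2 <= C.

Variables c1 c2 : R.
Hypotheses (c1_gt0 : 0 < c1) (c2_gt0 : 0 < c2).
Hypothesis vol : forall x k, (0 < k)%N ->
  c1 * k%:R ^+ 2 <= (#|` ball x k|)%:R <= c2 * k%:R ^+ 2.

(** Leaving the ball from a point at distance [r] of its complement costs about
    [log (rho / r)], and points with small [r] are rare. *)
Lemma total_deficit_le x0 rho T K : (0 < rho)%N ->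
    T%:R <= K * rho.+1%:R ^+ 2 ->
  \sum_(x <- ball x0 rho) \sum_(0 <= t < T) heat_kernel G t x x <=
  \sum_(x <- ball x0 rho) \sum_(0 <= t < T) killed (ball x0 rho) t x x +
  (C + A * K + 9 * A * (9 * c2 / c1 + 2)) * (#|` ball x0 rho|)%:R.
Proof.
move=> rho0 TK; set H := ball x0 rho.
pose r x := (rho.+1 - gdist G x0 x)%N.
pose M x := C + A * (K + 3 * \sum_(r x <= j < rho.+1) j%:R^-1).
have pointwise x : x \in H -> \sum_(0 <= t < T) heat_kernel G t x x <=
    \sum_(0 <= t < T) killed H t x x + M x.
  rewrite in_gball // => xr.
  (* Up to time [T] the walk from [x] does not see that it is killed outside
     [B]. *)
  pose B := (H `|` ball x T)%fset.
  have HB : (H `<=` B)%fset by rewrite fsubsetUl.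
  have r0 : (0 < r x <= rho.+1)%N by rewrite /r; lia.
  have sM (F : nat -> R) : (forall t, F t <= A / t.+1%:R) ->
      (forall t, F t * (r x)%:R ^+ 2 <= C) -> \sum_(0 <= t < T) F t <= M x.
    move=> FA FC; apply: le_trans (time_sum_le T r0 A_ge0 C_ge0 FA FC) _.
    rewrite lerD2l ler_wpM2l // lerD2r ler_pdivrMr // exprn_gt0 //.
  have M0 : 0 <= M x.
    apply: (@le_trans _ _ (\sum_(0 <= t < T) 0)); first by rewrite big1.
    by apply: sM => t; rewrite ?mul0r // divr_ge0.
  rewrite -lerBlDl -sumrB.
  rewrite big_nat (eq_bigr (fun t => killed B t x x - killed H t x x)) -?big_nat.
    apply: killing_deficit_le => // y yB; rewrite in_gball // -ltnNge => yH.
    apply: sM => t; first exact: time_bound.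
    apply: le_trans (dist_bound B t y x); rewrite ler_wpM2l ?killed_ge0 //.
    rewrite ler_sqr ?nnegrE // ler_nat /r (gdist_sym conn y x).
    by have := gdist_triangle conn x x0 y; lia.
  move=> t /andP[_ tT]; congr (_ - _); rewrite killed_heat_kernel // => z zt.
  by rewrite in_fsetU orbC in_gball //; have := leq_trans zt (ltnW tT); move=> ->.
apply: le_trans (ler_sum_seq pointwise) _.
rewrite big_split /= lerD2l /M.
have -> : (C + A * K + 9 * A * (9 * c2 / c1 + 2)) * (#|` H|)%:R =
  (C + A * K) * (#|` H|)%:R + 3 * A * (3 * (9 * c2 / c1 + 2) * (#|` H|)%:R) by ring.
rewrite (eq_big_seq (fun x => (C + A * K) * 1 +
    3 * A * \sum_(1 <= j < rho.+1) (x \in annulus G R x0 rho j)%:R / j%:R)); last first.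
  move=> x xH; rewrite mulr1 -addrA; congr (_ + _).
  rewrite mulrDr; congr (_ + _); rewrite mulrA [A * 3]mulrC; congr (_ * _).
  move: xH; rewrite in_gball // => xr.
  rewrite [RHS](big_cat_nat (n := r x)) /=; [|by rewrite /r; lia..].
  rewrite [X in _ = X + _]big_nat [X in _ = X + _]big1 ?add0r => [|j /andP[_ jr]].
    rewrite [LHS]big_nat [RHS]big_nat; apply: eq_bigr => j /andP[rj _].
    by rewrite in_annulus // xr /= (_ : (rho < _)%N) ?mul1r //; move: rj; rewrite /r; lia.
  rewrite in_annulus // xr /= (_ : (rho < _)%N = false) ?mul0r //.
  by apply/negbTE; move: jr; rewrite /r; lia.
have card1 : \sum_(x <- H) 1 = (#|` H|)%:R :> R by rewrite -sum1_size natr_sum.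
rewrite big_split /= -!mulr_sumr card1 lerD2l ler_wpM2l ?mulr_ge0 //.
apply: le_trans (annulus_sum_le conn bdeg c1_gt0 c2_gt0 vol x0 rho0).
rewrite exchange_big; apply: ler_sum => j _; rewrite -mulr_suml ler_wpM2r ?invr_ge0 //.
exact: sum_mem_le.
Qed.

End Deficit.

(** * Logarithmic sums *)

Section LogSums.
Variable R : realType.
Implicit Types (a b : R) (m n t : nat).

Lemma lnB_le a b : 0 < a -> 0 < b -> ln b - ln a <= (b - a) / a.
Proof.
move=> a0 b0; rewrite -ln_div ?posrE //.
have := @le_ln1Dx R (b / a - 1); rewrite addrCA subrr addr0 => /(_ _)/le_trans; apply.
  by rewrite ltrBrDr addrC subrr divr_gt0.
by rewrite mulrBl divff // gt_eqF.
Qed.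

Lemma lnB_ge a b : 0 < a -> 0 < b -> (b - a) / b <= ln b - ln a.
Proof.
move=> a0 b0; have := lnB_le b0 a0.
by rewrite -lerN2 opprB -mulNr opprB.
Qed.

Lemma ln_increment_ge t : (0 < t)%N -> t.+1%:R^-1 <= ln t.+1%:R - ln t%:R :> R.
Proof.
move=> t0; have := @lnB_ge t%:R t.+1%:R; rewrite !ltr0n t0 => /(_ isT isT).
by rewrite -[X in (X - _) / _]natr1 addrC addKr mul1r.
Qed.

Lemma harmonic_ge m n : (0 < m)%N -> (m <= n)%N ->
  ln n%:R - ln m%:R <= \sum_(m <= t < n) t%:R^-1 :> R.
Proof.
move=> m0 mn; rewrite -(telescope_sumr (fun t => ln t%:R)) // !big_nat.
apply: ler_sum => t /andP[mt _]; have t0 := leq_trans m0 mt.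
apply: le_trans (lnB_le _ _) _; rewrite ?ltr0n //.
by rewrite -natr1 addrC addKr mul1r.
Qed.

Lemma harmonic_le m n : (0 < m)%N -> (m <= n)%N ->
  \sum_(m <= t < n) t%:R^-1 <= ln n%:R - ln m%:R + 1 :> R.
Proof.
move=> m0 mn.
apply: (@le_trans _ _ (\sum_(m <= t < n) ((ln t.+1%:R - t.+1%:R^-1) - (ln t%:R - t%:R^-1)))).
  rewrite !big_nat; apply: ler_sum => t /andP[mt _]; have t0 := leq_trans m0 mt.
  have := ln_increment_ge t0.
  move: (t.+1%:R^-1) (t%:R^-1) (ln t.+1%:R) (ln t%:R) => u v p q; lra.
rewrite (telescope_sumr (fun t => ln t%:R - t%:R^-1)) //.
have : m%:R^-1 <= 1 :> R by rewrite invf_le1 ?ltr0n // ler1n.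
have : 0 <= n%:R^-1 :> R by rewrite invr_ge0.
lra.
Qed.

(** The derivative of [- u `^ (- (alpha - 1)) / (alpha - 1)] is decreasing. *)
Lemma powR_increment_le a b alpha : 0 < a -> 0 < b -> 1 < alpha ->
  b `^ (- alpha) * (b - a) <=
  (a `^ (- (alpha - 1)) - b `^ (- (alpha - 1))) / (alpha - 1).
Proof.
move=> a0 b0 alpha1; set e := alpha - 1.
have e0 : 0 < e by rewrite subr_gt0.
have be : b `^ (- alpha) = b `^ (- e) / b.
  rewrite -[b^-1]powR_inv1 ?ltW // -powRD; last by rewrite (gt_eqF b0) implybT.
  by congr (powR b _); rewrite /e; ring.
have ae : a `^ (- e) = b `^ (- e) * expR (e * (ln b - ln a)).
  by rewrite /powR !gt_eqF // -expRD; congr expR; ring.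
rewrite ler_pdivlMr // be ae; move: (b `^ (- e)) (powR_ge0 b (- e)) => c c0.
rewrite (_ : c / b * (b - a) * e = c * (e * ((b - a) / b))); last by ring.
rewrite (_ : c * expR _ - c = c * (expR (e * (ln b - ln a)) - 1)); last by ring.
rewrite ler_wpM2l //.
have := expR_ge1Dx (e * (ln b - ln a)).
have : e * ((b - a) / b) <= e * (ln b - ln a) by rewrite ler_wpM2l ?lnB_ge // ltW.
lra.
Qed.

Lemma ln_nat_gt0 t : (1 < t)%N -> 0 < ln t%:R :> R.
Proof. by move=> t1; rewrite ln_gt0 // ltr1n. Qed.

Lemma log_powR_sum_le alpha m n : (1 < m)%N -> (m <= n)%N -> 1 < alpha ->
  \sum_(m.+1 <= t < n.+1) ln t%:R `^ (- alpha) / t%:R <=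
  ln m%:R `^ (- (alpha - 1)) / (alpha - 1) :> R.
Proof.
move=> m1 mn alpha1.
pose F t : R := - (ln t%:R `^ (- (alpha - 1)) / (alpha - 1)).
rewrite big_add1 /=.
apply: (@le_trans _ _ (\sum_(m <= t < n) (F t.+1 - F t))).
  rewrite !big_nat; apply: ler_sum => t /andP[mt _]; have t1 := leq_trans m1 mt.
  rewrite /F opprK addrC -mulrBl.
  apply: le_trans (powR_increment_le (ln_nat_gt0 t1) (ln_nat_gt0 (leqW t1)) alpha1).
  by rewrite ler_wpM2l ?powR_ge0 // ln_increment_ge // ltnW.
rewrite telescope_sumr // /F opprK addrC gerDl oppr_le0.
by rewrite divr_ge0 ?powR_ge0 // subr_ge0 ltW.
Qed.

Lemma log_inv_sum_le m n : (1 < m)%N -> (m <= n)%N ->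
  \sum_(m.+1 <= t < n.+1) (ln t%:R)^-1 / t%:R <=
  ln (ln n%:R) - ln (ln m%:R) :> R.
Proof.
move=> m1 mn; rewrite big_add1 /=.
rewrite -(telescope_sumr (fun t => ln (ln t%:R))) // !big_nat.
apply: ler_sum => t /andP[mt _]; have t1 := leq_trans m1 mt.
apply: le_trans (lnB_ge (ln_nat_gt0 t1) (ln_nat_gt0 (leqW t1))).
rewrite [leLHS]mulrC ler_wpM2r ?ln_increment_ge //; last exact: ltnW.
by rewrite invr_ge0 ltW // ln_nat_gt0 // leqW.
Qed.

End LogSums.

(** * The heat trace *)

Section HeatTrace.
Variables (V : choiceType) (G : sgraph V) (R : realType).
Hypotheses (inf : infinite_graph V) (conn : connected_graph G).
Hypothesis bdeg : bounded_degree G.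
Implicit Types (x y : V) (t T : nat) (H : {fset V}).

Local Notation hk := (@heat_kernel V G R).
Local Notation ball x k := (gball G x (k%:R : R)).

Lemma heat_kernel_le1 t x y : hk t x y <= 1.
Proof.
rewrite -(@killed_heat_kernel _ _ _ conn bdeg (ball x t)) ?killed_le1 // => z zt.
by rewrite in_gball.
Qed.

Lemma heat_trace_expansion H (g : R) (e : nat -> R) m T : (0 < #|` H|)%N ->
    (0 < m <= T)%N ->
    (forall t, (m <= t)%N ->
       `| (#|` H|)%:R^-1 * \sum_(x <- H) (t%:R * hk t x x - g) | <= e t) ->
  `| \sum_(x <- H) \sum_(0 <= t < T) hk t x x -
     g * (#|` H|)%:R * \sum_(m <= t < T) t%:R^-1 | <=
  (#|` H|)%:R * (m%:R + \sum_(m <= t < T) e t / t%:R).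
Proof.
move=> H0 /andP[m0 mT] He; set N : R := (#|` H|)%:R.
have N0 : 0 < N by rewrite ltr0n.
have cardH (c : R) : \sum_(x <- H) c = N * c.
  by rewrite /N -sum1_size natr_sum mulr_suml; apply: eq_bigr => x _; rewrite mul1r.
rewrite exchange_big /= (big_cat_nat (n := m)) //= -addrA.
apply: le_trans (ler_normD _ _) _; rewrite mulrDr; apply: lerD.
  rewrite ger0_norm; last first.
    by apply: sumr_ge0 => t _; apply: sumr_ge0 => x _; apply: heat_kernel_ge0.
  apply: le_trans (sum_nat_le_const (c := N) (ltW N0) _) _.
    move=> t _; rewrite -[leRHS]mulr1 -cardH.
    by apply: ler_sum => x _; apply: heat_kernel_le1.
  by rewrite subn0 mulrC.
rewrite !mulr_sumr -sumrB; apply: le_trans (ler_norm_sum _ _ _) _.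
rewrite !big_nat; apply: ler_sum => t /andP[mt _].
have t0 : 0 < t%:R :> R by rewrite ltr0n (leq_trans m0).
have -> : \sum_(x <- H) hk t x x - g * N / t%:R =
    N / t%:R * (N^-1 * \sum_(x <- H) (t%:R * hk t x x - g)).
  rewrite sumrB cardH -mulr_sumr; field.
  by rewrite !gt_eqF.
rewrite normrM gtr0_norm ?divr_gt0 // [leRHS]mulrA [leRHS]mulrAC.
by rewrite ler_wpM2l ?He // divr_ge0 ?ltW.
Qed.

Variables A C c1 c2 : R.
Hypotheses (A_ge0 : 0 <= A) (C_ge0 : 0 <= C).
Hypothesis time_bound : forall H n x y, killed G R H n x y <= A / n.+1%:R.
Hypothesis dist_bound : forall H n x y,
  killed G R H n x y * (gdist G x y)%:R ^+ 2 <= C.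
Hypotheses (c1_gt0 : 0 < c1) (c2_gt0 : 0 < c2).
Hypothesis vol : forall x k, (0 < k)%N ->
  c1 * k%:R ^+ 2 <= (#|` ball x k|)%:R <= c2 * k%:R ^+ 2.

(** After a time [L |B|] with [L >= 2 A], the walk started in [B] has left it
    with probability at least one half, simply because the heat kernel has no
    room for more mass; the heat trace up to that time is all of the zeta value
    up to a bounded amount per vertex. *)
Lemma zeta1_heat_trace x0 L rho : 2 * A <= L%:R -> (0 < rho)%N ->
  `| zeta1 G R (ball x0 rho) -
     \sum_(x <- ball x0 rho) \sum_(0 <= t < L * #|` ball x0 rho|) hk t x x | <=
  (2 * A + (C + A * (L%:R * c2) + 9 * A * (9 * c2 / c1 + 2))) *
    (#|` ball x0 rho|)%:R.
Proof.
move=> LA rho0; set B := ball x0 rho; set T := (L * _)%N.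
have T0 : 0 < T.+1%:R :> R by [].
have half x : \sum_(y <- B) killed G R B T x y <= 2^-1.
  apply: (@le_trans _ _ (\sum_(y <- B) A / T.+1%:R)).
    by apply: ler_sum => y _; apply: time_bound.
  rewrite -mulr_suml ler_pdivrMr //.
  have -> : \sum_(y <- B) A = A * (#|` B|)%:R.
    by rewrite -sum1_size natr_sum mulr_sumr; apply: eq_bigr => x' _; rewrite mulr1.
  have : 2 * A * (#|` B|)%:R <= T%:R by rewrite natrM ler_wpM2r.
  have -> : T.+1%:R = T%:R + 1 :> R by rewrite natr1.
  lra.
have /andP[lo up] := zeta1_bounds inf conn bdeg half (fun x y => time_bound B T x y).
have TK : T%:R <= L%:R * c2 * rho.+1%:R ^+ 2.
  rewrite natrM -mulrA ler_wpM2l //; case/andP: (vol x0 rho0) => _ /le_trans; apply.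
  by apply: ler_wpM2l; rewrite ?(ltW c2_gt0) // ler_sqr ?nnegrE // ler_nat.
have deficit := total_deficit_le inf conn bdeg A_ge0 C_ge0 time_bound dist_bound
  c1_gt0 c2_gt0 vol x0 rho0 TK.
have below : \sum_(x <- B) \sum_(0 <= t < T) killed G R B t x x <=
    \sum_(x <- B) \sum_(0 <= t < T) hk t x x.
  by apply: ler_sum => x _; apply: ler_sum => t _; apply: killed_le_heat_kernel.
have tail : 2 * T%:R * (A / T.+1%:R) * (#|` B|)%:R <= 2 * A * (#|` B|)%:R.
  rewrite ler_wpM2r // mulrA ler_pdivrMr // mulrAC ler_wpM2l ?mulr_ge0 //.
  by rewrite ler_nat.
have A2 : 0 <= 2 * A * (#|` B|)%:R by rewrite !mulr_ge0.
have C2 : 0 <= (C + A * (L%:R * c2) + 9 * A * (9 * c2 / c1 + 2)) * (#|` B|)%:R.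
  by rewrite mulr_ge0 // !addr_ge0 ?mulr_ge0 ?addr_ge0 ?divr_ge0 ?mulr_ge0 // ltW.
rewrite [leRHS]mulrDl ler_norml; apply/andP.
move: ((C + _ + _) * _) C2 deficit => K K0 deficit.
have {tail}up : zeta1 G R B <= \sum_(x <- B) \sum_(0 <= t < T) killed G R B t x x +
    2 * A * (#|` B|)%:R by apply: le_trans up _; rewrite lerD2l.
by split; lra.
Qed.

End HeatTrace.

(** * The asymptotics of the zeta value *)

Section Asymptotics.
Variables (R : realType) (V : choiceType) (G : sgraph V).
Hypotheses (inf : infinite_graph V) (conn : connected_graph G).
Hypotheses (bdeg : bounded_degree G) (vol : VG2 G R).
Implicit Types (x : V) (t : nat).

(** The diagonal upper bound, extended to all times and all killed kernels. *)
Lemma killed_diag_le (a2 t0 : R) : 0 < a2 ->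
    (forall x t, (0 < t)%N -> t0 <= t%:R -> heat_kernel G t x x <= a2 * t%:R^-1) ->
  exists2 a, 0 < a & forall H t x, killed G R H t x x <= a / t.+1%:R.
Proof.
move=> a20 diag; pose t1 := (Num.truncn t0).+1.
have t01 : t0 <= t1%:R by rewrite ltW // truncnS_gt.
exists (2 * a2 + t1%:R) => [|H t x]; first by rewrite addr_gt0 ?mulr_gt0 // ltr0n.
rewrite ler_pdivlMr //; case: (ltnP t t1) => [tt1|t1t].
  apply: (@le_trans _ _ t.+1%:R); first by rewrite ler_piMl // killed_le1.
  apply: (@le_trans _ _ t1%:R); first by rewrite ler_nat.
  by rewrite lerDr mulr_ge0 // ltW.
have t_gt0 : (0 < t)%N by apply: leq_trans t1t.
apply: (@le_trans _ _ (a2 / t%:R * t.+1%:R)).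
  rewrite ler_wpM2r //; apply: le_trans (killed_le_heat_kernel R bdeg H t x x) _.
  by apply: diag => //; apply: le_trans t01 _; rewrite ler_nat.
rewrite mulrAC ler_pdivrMr ?ltr0n //.
apply: (@le_trans _ _ (a2 * (2 * t%:R))).
  by apply: ler_wpM2l; [exact: ltW | rewrite -natrM ler_nat; lia].
by rewrite mulrCA mulrA ler_wpM2r // lerDl.
Qed.

(** All error terms except the accumulated deviation of the averaged diagonal
    heat kernel from [g / t] are bounded per vertex. *)
Lemma zeta1_expansion (a2 t0 : R) : 0 < a2 ->
    (forall x t, (0 < t)%N -> t0 <= t%:R -> heat_kernel G t x x <= a2 * t%:R^-1) ->
  exists (C1 : R) (L m : nat), [/\ 0 <= C1, (1 < m < L)%N, t0 <= m%:R &
    forall (g : R) (e : nat -> R) (x0 : V) (rho : nat) , 0 <= g ->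
    let B := gball G x0 (rho%:R : R) in (1 < #|` B|)%N ->
    (forall t, (m < t)%N ->
      `| (#|` B|)%:R^-1 * \sum_(x <- B) (t%:R * heat_kernel G t x x - g) | <= e t) ->
    `| zeta1 G R B - g * (#|` B|)%:R * ln (#|` B|)%:R | <=
    (#|` B|)%:R * (C1 * (1 + g) + \sum_(m.+1 <= t < L * #|` B|) e t / t%:R)].
Proof.
move=> a20 diag.
have [a a0 killed_a] := killed_diag_le a20 diag.
have [D degD] : exists D : R, forall x, (deg G x)%:R <= D.
  by have [D hD] := bdeg; exists D%:R => x; rewrite ler_nat; case: (hD x).
have [c1 [c2 [c10 c20 volR]]] := vol.
have volN x k : (0 < k)%N ->
    c1 * k%:R ^+ 2 <= (#|` gball G x (k%:R : R)|)%:R <= c2 * k%:R ^+ 2.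
  by move=> k0; apply/andP; apply: volR; rewrite ler1n.
have Dpos x : 0 <= D * a := mulr_ge0 (le_trans (ler0n _ _) (degD x)) (ltW a0).
pose A := 2 * (D * a); pose m := (Num.truncn t0).+2.
(* The first term makes [L >= 2 A], the second keeps the time horizon beyond
   [m]. *)
pose L := maxn (Num.truncn (2 * A)).+1 m.+1.
pose C2 := 2 * A + (138 * (D * a) + A * (L%:R * c2) + 9 * A * (9 * c2 / c1 + 2)).
pose C3 := ln L%:R + ln m.+1%:R + 1 : R.
have lnL0 : 0 <= ln L%:R :> R by rewrite ln_ge0 // ler1n /L; lia.
have lnm0 : 0 <= ln m.+1%:R :> R by rewrite ln_ge0 // ler1n.
have C30 : 0 <= C3 by apply: addr_ge0 => //; apply: addr_ge0.
exists (`|C2| + m.+1%:R + C3), L, m; split.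
- by apply: addr_ge0; [apply: addr_ge0 | exact: C30].
- by rewrite /L; lia.
- by apply: (@le_trans _ _ (Num.truncn t0).+1%:R); [exact/ltW/truncnS_gt | rewrite ler_nat].
move=> g e x0 rho g0 B B1 He; set N : R := (#|` B|)%:R.
have N0 : 0 < N by rewrite ltr0n ltnW.
have rho0 : (0 < rho)%N.
  rewrite lt0n; apply: contraL B1 => /eqP r0; rewrite -leqNgt.
  rewrite -(cardfs1 x0) fsubset_leq_card //; apply/fsubsetP => y.
  by rewrite /B r0 in_gball // leqn0 inE => /eqP /(gdist_eq0 conn) ->.
have LA : 2 * A <= L%:R.
  by apply: (@le_trans _ _ (Num.truncn (2 * A)).+1%:R);
    [exact/ltW/truncnS_gt | rewrite ler_nat leq_maxl].
have A0 : 0 <= A by rewrite mulr_ge0 // (Dpos x0).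
have zeta_trace := zeta1_heat_trace inf conn bdeg A0
  (_ : 0 <= 138 * (D * a)) (killed_le_time inf conn bdeg degD killed_a)
  (killed_le_dist inf conn bdeg degD killed_a) c10 c20 volN x0 LA rho0.
have {}zeta_trace := zeta_trace (mulr_ge0 (ler0n _ 138) (Dpos x0)).
have mT : (0 < m.+1 <= L * #|` B|)%N.
  by rewrite /= (@leq_trans L) ?leq_maxr // leq_pmulr // ltnW.
have expansion := heat_trace_expansion inf conn bdeg (ltnW B1) mT He.
have lnT : ln (L * #|` B|)%:R = ln L%:R + ln N :> R.
  by rewrite natrM lnM ?posrE // ltr0n /L; lia.
have harm : `| \sum_(m.+1 <= t < L * #|` B|) t%:R^-1 - ln N | <= C3.
  have /andP[m0 mLT] := mT.
  have := harmonic_ge R m0 mLT; have := harmonic_le R m0 mLT; rewrite lnT /C3 ler_norml.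
  move: (bigop.body _ _ _) (ln L%:R) (ln m.+1%:R) (ln N) lnL0 lnm0 => s u v w u0 v0 h1 h2.
  by clear -u0 v0 h1 h2; apply/andP; split; lra.
rewrite -/B -/N in zeta_trace expansion *.
set S := \sum_(x <- B) _ in zeta_trace expansion.
set E := \sum_(m.+1 <= t < _) (e t / _) in expansion *.
set Hs := \sum_(m.+1 <= t < _) _^-1 in expansion harm.
have -> : zeta1 G R B - g * N * ln N =
  (zeta1 G R B - S) + (S - g * N * Hs) + g * N * (Hs - ln N) by ring.
apply: le_trans (ler_normD _ _) _; apply: le_trans (lerD (ler_normD _ _) (lexx _)) _.
have h3 : `|g * N * (Hs - ln N)| <= g * N * C3.
  have gN0 : 0 <= g * N := mulr_ge0 g0 (ltW N0).
  by rewrite normrM (ger0_norm gN0) ler_wpM2l.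
have h1 : `|zeta1 G R B - S| <= `|C2| * N.
  by apply: le_trans zeta_trace _; apply: ler_wpM2r; [exact: ltW | exact: ler_norm].
apply: le_trans (lerD (lerD h1 expansion) h3) _.
have : 0 <= N * (g * (`|C2| + m.+1%:R) + C3).
  by apply: mulr_ge0; [exact: ltW | rewrite addr_ge0 // mulr_ge0 // addr_ge0].
move: (`|C2|) (m.+1%:R) => u v; rewrite -subr_ge0 => h; rewrite -subr_ge0.
by move: h; rewrite subr0; congr (0 <= _); ring.
Qed.

End Asymptotics.

Theorem proposition1p7 (R : realType) (V : choiceType) (G : sgraph V)
  (Ginf : infinite_graph V) (Gconn : connected_graph G)
  (Gdeg : bounded_degree G) (Gvol : VG2 G R) (GPI : poincare G R)
  (x0 : V) (rad : nat -> R) (rad_ge0 : forall n, 0 <= rad n)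
  (Gexh : exhaustion (fun n => gball G x0 (rad n)))
  (N : nat -> R) (NE : forall n, N n = (#|` gball G x0 (rad n)|)%:R)
  (Ninfty : N n @[n --> \oo] --> +oo)
  (a1 a2 g t0 C alpha : R)
  (a1_gt0 : 0 < a1) (a2_gt0 : 0 < a2) (g_gt0 : 0 < g) (alpha_gt0 : 0 < alpha)
  (Hdiag : forall (x : V) (t : nat), (0 < t)%N -> t0 <= t%:R ->
     a1 * t%:R^-1 <= heat_kernel G t x x
     /\ heat_kernel G t x x <= a2 * t%:R^-1)
  (Havg : forall t n : nat, (1 < t)%N -> t0 <= t%:R ->
     `| (N n)^-1 * \sum_(x <- gball G x0 (rad n))
                      (t%:R * heat_kernel G t x x - g) |
     <= C * ln t%:R `^ (- alpha)) :
  (1 < alpha ->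
     (fun n => zeta1 G R (gball G x0 (rad n)) - g * N n * ln (N n))
       =O_\oo N) /\
  (alpha = 1 ->
     (fun n => zeta1 G R (gball G x0 (rad n)) - g * N n * ln (N n))
       =O_\oo (fun n => N n * ln (ln (N n)))).
Proof.
have upper x t (t_gt0 : (0 < t)%N) (tt0 : t0 <= t%:R) := (Hdiag x t t_gt0 tt0).2.
have [C1 [L [m [C10 /andP[m1 mL] t0m expansion]]]] :=
  zeta1_expansion Ginf Gconn Gdeg Gvol a2_gt0 upper.
have ballE n : gball G x0 (rad n) = gball G x0 ((Num.truncn (rad n))%:R : R).
  exact: gball_truncn.
pose T n := (L * #|` gball G x0 (rad n)|).-1.
pose err n := \sum_(m.+1 <= t < (T n).+1) ln t%:R `^ (- alpha) / t%:R : R.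
have large n : 2 <= N n -> (m <= T n)%N.
  by rewrite NE ler_nat /T => card2; rewrite -ltnS prednK; nia.
have main n : 2 <= N n ->
    `| zeta1 G R (gball G x0 (rad n)) - g * N n * ln (N n) | <=
    N n * (C1 * (1 + g) + `|C| * err n).
  rewrite NE => card2.
  have avg t : (m < t)%N ->
      `| (#|` gball G x0 (rad n)|)%:R^-1 *
         \sum_(x <- gball G x0 (rad n)) (t%:R * heat_kernel G t x x - g) | <=
      `|C| * ln t%:R `^ (- alpha).
    move=> mt; rewrite -NE; apply: le_trans (Havg t n _ _) _.
    - exact: ltn_trans mt.
    - by apply: le_trans t0m _; rewrite ler_nat ltnW.
    - by rewrite ler_wpM2r ?powR_ge0 // ler_norm.
  move: (expansion g (fun t => `|C| * ln t%:R `^ (- alpha)) x0 (Num.truncn (rad n)) (ltW g_gt0)).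
  have card2' : (1 < #|` gball G x0 (rad n)|)%N by rewrite -(ler_nat R).
  rewrite -ballE /= => /(_ card2' avg)/le_trans; apply.
  rewrite ler_wpM2l // lerD2l /err mulr_sumr /T prednK; last first.
    by move: card2; rewrite ler_nat; nia.
  by apply: ler_sum => t _; rewrite mulrA.
have Nlarge (M : R) : \forall n \near \oo, M <= N n.
  by move/cvgryPge : Ninfty.
have CG0 : 0 <= C1 * (1 + g) := mulr_ge0 C10 (addr_ge0 ler01 (ltW g_gt0)).
split=> [alpha1|alpha1].
  pose K := C1 * (1 + g) + `|C| * (ln m%:R `^ (- (alpha - 1)) / (alpha - 1)).
  have K0 : 0 <= K.
    apply: addr_ge0; first exact: CG0.
    by rewrite mulr_ge0 // divr_ge0 ?powR_ge0 // subr_ge0 ltW.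
  apply/eqO_exP; exists (K + 1); first by rewrite ltr_wpDl.
  near=> n; have N2 : 2 <= N n by near: n; exact: Nlarge.
  have N0 : 0 <= N n by lra.
  apply: le_trans (main n N2) _; rewrite (ger0_norm N0) mulrC ler_wpM2r //.
  apply: (@le_trans _ _ K); last by rewrite lerDl.
  by rewrite lerD2l ler_wpM2l // /err log_powR_sum_le // large.
pose K := C1 * (1 + g) + `|C| * (ln 2 + `|ln (ln m%:R)|) + `|C|.
have ln20 : 0 <= ln 2 :> R by rewrite ln_ge0 // ler1n.
have K0 : 0 <= K.
  by apply: addr_ge0 => //; apply: addr_ge0; [exact: CG0 | apply: mulr_ge0 => //; apply: addr_ge0].
apply/eqO_exP; exists (K + 1); first by rewrite ltr_wpDl.
near=> n.
have N2 : 2 <= N n by near: n; exact: Nlarge.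
have NL : L%:R <= N n by near: n; exact: Nlarge.
have Nee : expR (expR 1) <= N n by near: n; exact: Nlarge.
have N0 : 0 < N n by lra.
have lnN1 : expR 1 <= ln (N n) by rewrite -(expRK (expR 1)) ler_ln ?posrE ?expR_gt0.
have lnN0 : 0 < ln (N n) := lt_le_trans (expR_gt0 1) lnN1.
have llN1 : 1 <= ln (ln (N n)) by rewrite -[leLHS](expRK 1) ler_ln ?posrE ?expR_gt0.
have errE : err n <= ln 2 + `|ln (ln m%:R)| + ln (ln (N n)).
  rewrite /err alpha1.
  rewrite (eq_bigr (fun t => (ln t%:R)^-1 / t%:R)); last first.
    move=> t _; case: t => [|t]; first by rewrite invr0 !mulr0.
    by rewrite powR_inv1 // ln_ge0 // ler1n.
  apply: le_trans (log_inv_sum_le R m1 (large n N2)) _.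
  have T1 : (1 < T n)%N := leq_trans m1 (large n N2).
  (* Since [L <= N n], the horizon [T n] is at most [N n ^ 2]. *)
  have : ln (ln (T n)%:R) <= ln 2 + ln (ln (N n)).
    rewrite -lnM ?posrE // ler_ln ?posrE ?mulr_gt0 ?ln_nat_gt0 //.
    apply: (@le_trans _ _ (ln (N n * N n))).
      rewrite ler_ln ?posrE ?mulr_gt0 ?ltr0n //; last exact: ltnW.
      apply: (@le_trans _ _ (L%:R * N n)); last by rewrite ler_wpM2r // ltW.
      by rewrite NE -natrM ler_nat /T leq_pred.
    by rewrite lnM ?posrE // mulr2n mulrDl mul1r.
  have : - ln (ln m%:R) <= `|ln (ln m%:R)| :> R by rewrite -normrN ler_norm.
  move: (ln (ln (T n)%:R)) (ln (ln m%:R)) (ln (ln (N n))) (ln 2) => v u w c.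
  move: (`|u|) => u'; clear; lra.
apply: le_trans (main n N2) _.
have llN0 : 0 <= ln (ln (N n)) := le_trans ler01 llN1.
rewrite (ger0_norm (mulr_ge0 (ltW N0) llN0)) mulrCA.
apply: ler_wpM2l; first exact: ltW.
apply: (@le_trans _ _ (K * ln (ln (N n)))); last by rewrite ler_wpM2r // lerDl.
have C0 := normr_ge0 C.
have := ler_wpM2l C0 errE; rewrite !mulrDr => errC.
have : (C1 * (1 + g) + `|C| * (ln 2 + `|ln (ln m%:R)|)) <=
       (C1 * (1 + g) + `|C| * (ln 2 + `|ln (ln m%:R)|)) * ln (ln (N n)).
  by rewrite ler_peMr // addr_ge0 // mulr_ge0 // addr_ge0.
by rewrite /K [in leRHS]mulrDl !mulrDr; lra.
Unshelve. all: by end_near.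
Qed.
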